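(* Let $c$ be an arbitrary choice of coefficients (for the root system $R$ and the field $K$) and let $\mathcal X$ be the associated category of graded spaces with operators. Then the following holds. (1) For every $\lambda\in X$ there is an up to isomorphism unique object $S(\lambda)$ in $\mathcal X$ with the following properties: (a) $S(\lambda)$ is indecomposable; (b) $S(\lambda)_\lambda$ is a one-dimensional vector space, and $S(\lambda)_\mu\neq 0$ implies $\mu\le\lambda$. (2) The objects $S(\lambda)$ characterized in (1) satisfy, for all $\lambda,\mu\in X$, $\operatorname{Hom}_{\mathcal X}(S(\lambda),S(\mu))=0$ if $\mu\neq\lambda$, and $\operatorname{Hom}_{\mathcal X}(S(\lambda),S(\mu))=K\cdot\operatorname{id}_{S(\lambda)}$ if $\mu=\lambda$. (3) For any object $M$ in $\mathcal X$ there exist an index set $J$ and weights $\lambda_j\in X$ for $j\in J$ such that $M\cong\bigoplus_{j\in J}S(\lambda_j)$. The multiset of weights $\{\lambda_j\}$ is uniquely determined by $M$.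
   Context: $R$ is a root system with basis $\Pi$ and weight lattice $X$; $\alpha^\vee$ denotes the coroot of $\alpha\in R$. The partial order on $X$ is: $\mu\le\lambda$ iff $\lambda-\mu$ is a (possibly empty) sum of elements of $\Pi$. A subset $T\subset X$ is quasi-bounded (from above) if for all $\mu\in X$ the set $\{\lambda\in T\mid \mu\le\lambda\}$ is finite. $K$ is a field. A choice of coefficients is a map $c\colon X\times\Pi\times\mathbb Z_{\ge0}^2\times\mathbb Z\to K$, $(\mu,\alpha,m,n,r)\mapsto c_{\mu,\alpha,m,n,r}$, with $c_{\mu,\alpha,m,n,0}=1$ and $c_{\mu,\alpha,m,n,r}=0$ for $r<0$, for all $\mu,\alpha,m,n$. The category $\mathcal X$ (depending on $R,K,c$): objects are $X$-graded $K$-vector spaces $M=\bigoplus_{\mu\in X}M_\mu$ with $K$-linear operators $E_{\alpha,n}=E_{\mu,\alpha,n}\colon M_\mu\to M_{\mu+n\alpha}$ and $F_{\alpha,n}=F_{\mu,\alpha,n}\colon M_{\mu+n\alpha}\to M_\mu$ for all $\mu\in X$, $\alpha\in\Pi$, $n>0$ (with conventions $E_{\mu,\alpha,0}=F_{\mu,\alpha,0}=\operatorname{id}_{M_\mu}$ and $E_{\mu,\alpha,n}=0$, $F_{\mu,\alpha,n}=0$ for $n<0$), such that: (X1) The set of weights of $M$ (i.e. of $\mu$ with $M_\mu\ne0$) is quasi-bounded from above and each $M_\mu$ is finite dimensional. (X2) For all $\mu\in X$, $\alpha,\beta\in\Pi$, $m,n>0$ and $v\in M_{\mu+n\beta}$: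 $E_{\alpha,m}F_{\beta,n}(v)=F_{\beta,n}E_{\alpha,m}(v)$ if $\alpha\neq\beta$, and $E_{\alpha,m}F_{\alpha,n}(v)=\sum_{r\in\mathbb Z}c_{\mu,\alpha,m,n,r}F_{\alpha,n-r}E_{\alpha,m-r}(v)$ if $\alpha=\beta$. (X3) For all $\mu\in X$: $M_\mu=\ker E_\mu\oplus\operatorname{im}F_\mu$, where $M_{\delta\mu}:=\bigoplus_{\alpha\in\Pi,n>0}M_{\mu+n\alpha}$, $E_\mu\colon M_\mu\to M_{\delta\mu}$ has components $E_{\mu,\alpha,n}$, and $F_\mu\colon M_{\delta\mu}\to M_\mu$ is $(v_{\mu+n\alpha})\mapsto\sum_{\alpha,n}F_{\mu,\alpha,n}(v_{\mu+n\alpha})$. Morphisms are grading-preserving $K$-linear maps commuting with all $E$- and $F$-operators. Direct sums are formed degreewise; an arbitrary direct sum of objects of $\mathcal X$ is again an object of $\mathcal X$ as long as each weight space is finite dimensional and the set of weights is quasi-bounded. *)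

(* Defs.v *)
From HB Require Import structures.
From mathcomp Require Import all_boot all_order all_algebra.
From mathcomp Require Import mathcomp_extra boolp classical_sets functions.
From mathcomp Require Import cardinality fsbigop.

Set Implicit Arguments.
Unset Strict Implicit.
Unset Printing Implicit Defensive.

Import Order.TTheory GRing.Theory Num.Theory.
Local Open Scope classical_set_scope.
Local Open Scope ring_scope.

(* Crystallographic root systems, not assumed reduced (the results hold in
   both cases). Only the values of [coroot] on roots are meaningful; there they
   are determined by the other fields. *)
Record root_system (F : archiRealFieldType) (V : vectType F) := RootSystem {
  roots : seq V;
  coroot : V -> {scalar V};
  roots_neq0 : 0 \notin roots;
  roots_span : <<roots>>%VS = fullv;
  coroot_root : forall a, a \in roots -> coroot a a = 2;
  roots_refl : forall a b, a \in roots -> b \in roots ->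
    b - coroot a b *: a \in roots;
  coroot_int : forall a b, a \in roots -> b \in roots ->
    coroot a b \is a Num.int }.

Record root_basis (F : archiRealFieldType) (V : vectType F)
    (R : root_system V) := RootBasis {
  simple : seq V;
  simple_roots : {subset simple <= roots R};
  simple_basis : basis_of fullv simple;
  simple_sign : forall b, b \in roots R -> exists k : V -> nat,
    b = \sum_(a <- simple) a *+ k a \/ b = - \sum_(a <- simple) a *+ k a }.

Section WeightLattice.
Variables (F : archiRealFieldType) (V : vectType F) (R : root_system V).

Definition integral_weight : {pred V} :=
  fun v => all (fun a => coroot R a v \is a Num.int) (roots R).

Fact integral_weight_zmod_closed : zmod_closed integral_weight.
Proof.
split=> [|u v /allP hu /allP hv]; apply/allP => a ha.
  by rewrite linear0 rpred0.
by rewrite linearB rpredB ?hu ?hv.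
Qed.
HB.instance Definition _ :=
  GRing.isZmodClosed.Build V integral_weight integral_weight_zmod_closed.

Record weight := Weight { wval : V; _ : wval \in integral_weight }.
HB.instance Definition _ := [isSub for wval].
HB.instance Definition _ := [Choice of weight by <:].
HB.instance Definition _ := [SubChoice_isSubZmodule of weight by <:].

End WeightLattice.

Section Setting.
Variables (F : archiRealFieldType) (V : vectType F) (R : root_system V).
Variables (Pi : root_basis R).
Local Notation X := (weight R).

Definition simple_root := seq_sub (simple Pi).

Fact simple_root_integral (a : simple_root) : val a \in integral_weight R.
Proof.
by apply/allP => b hb; apply: coroot_int => //; apply: simple_roots (valP a).
Qed.
Definition wt (a : simple_root) : X := Weight (simple_root_integral a).

Definition wle (mu la : X) : Prop :=
  exists s : seq simple_root, la - mu = \sum_(a <- s) wt a.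

Definition quasi_bounded (T : set X) : Prop :=
  forall mu, finite_set [set la | T la /\ wle mu la].

Variable K : fieldType.

Record coefficients := Coefficients {
  coef :> X -> simple_root -> nat -> nat -> int -> K;
  coef_0 : forall mu a m n, coef mu a m n 0 = 1;
  coef_neg : forall mu a m n r, r < 0 -> coef mu a m n r = 0 }.

End Setting.

(* The direct sum of a family of vector spaces over an arbitrary index type,
   as the space of finitely supported families. *)
Section DirectSum.
Variables (K : fieldType) (J : Type) (N : J -> lmodType K).

Record dsum := Dsum {
  dval :> forall j, N j;
  dsum_finite : finite_set [set j | dval j <> 0] }.

Lemma dsumP (u v : dsum) : (forall j, u j = v j) -> u = v.
Proof.
case: u v => [u hu] [v hv] /= e.
have {}e : u = v by apply: functional_extensionality_dep.
by case: _ / e hv => hv; congr Dsum; apply: Prop_irrelevance.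
Qed.

HB.instance Definition _ := gen_eqMixin dsum.
HB.instance Definition _ := gen_choiceMixin dsum.

Fact dsum0_finite : finite_set [set j | (fun=> 0 : N j) j <> 0].
Proof. by apply: sub_finite_set (finite_set0 J) => j /=. Qed.
Definition dsum0 : dsum := Dsum dsum0_finite.

Fact dsumN_finite (u : dsum) : finite_set [set j | - u j <> 0].
Proof.
apply: sub_finite_set (dsum_finite u) => j /= h e; apply: h.
by rewrite e oppr0.
Qed.
Definition dsumN u : dsum := Dsum (dsumN_finite u).

Fact dsumD_finite (u v : dsum) : finite_set [set j | u j + v j <> 0].
Proof.
have h : finite_set ([set j | u j <> 0] `|` [set j | v j <> 0]).
  by rewrite finite_setU; split; apply: dsum_finite.
apply: sub_finite_set h => j /= h.
have [e|] := pselect (u j = 0); last by left.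
by right=> e'; apply: h; rewrite e e' addr0.
Qed.
Definition dsumD u v : dsum := Dsum (dsumD_finite u v).

Fact dsumZ_finite (k : K) (u : dsum) : finite_set [set j | k *: u j <> 0].
Proof.
apply: sub_finite_set (dsum_finite u) => j /= h e; apply: h.
by rewrite e scaler0.
Qed.
Definition dsumZ k u : dsum := Dsum (dsumZ_finite k u).

Fact dsumA : associative dsumD.
Proof. by move=> u v w; apply: dsumP => j /=; rewrite addrA. Qed.
Fact dsumC : commutative dsumD.
Proof. by move=> u v; apply: dsumP => j /=; rewrite addrC. Qed.
Fact dsum0l : left_id dsum0 dsumD.
Proof. by move=> u; apply: dsumP => j /=; rewrite add0r. Qed.
Fact dsumNl : left_inverse dsum0 dsumN dsumD.
Proof. by move=> u; apply: dsumP => j /=; rewrite addNr. Qed.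
HB.instance Definition _ :=
  GRing.isZmodule.Build dsum dsumA dsumC dsum0l dsumNl.

Fact dsumZA k l u : dsumZ k (dsumZ l u) = dsumZ (k * l) u.
Proof. by apply: dsumP => j /=; rewrite scalerA. Qed.
Fact dsum1Z : left_id 1 dsumZ.
Proof. by move=> u; apply: dsumP => j /=; rewrite scale1r. Qed.
Fact dsumZDr : right_distributive dsumZ +%R.
Proof. by move=> k u v; apply: dsumP => j /=; rewrite scalerDr. Qed.
Fact dsumZDl u : {morph dsumZ^~ u : k l / k + l}.
Proof. by move=> k l; apply: dsumP => j /=; rewrite scalerDl. Qed.
HB.instance Definition _ :=
  GRing.Zmodule_isLmodule.Build K dsum dsumZA dsum1Z dsumZDr dsumZDl.

End DirectSum.

Section DirectSumMap.
Variables (K : fieldType) (J : Type) (N N' : J -> lmodType K).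
Variable f : forall j, {linear N j -> N' j}.

Fact dsum_map_finite (u : dsum N) : finite_set [set j | f j (u j) <> 0].
Proof.
apply: sub_finite_set (dsum_finite u) => j /= h e; apply: h.
by rewrite e linear0.
Qed.
Definition dsum_map (u : dsum N) : dsum N' := Dsum (dsum_map_finite u).

Fact dsum_map_linear : linear dsum_map.
Proof. by move=> k u v; apply: dsumP => j /=; rewrite linearP. Qed.
HB.instance Definition _ :=
  GRing.isLinear.Build K (dsum N) (dsum N') _ dsum_map dsum_map_linear.
End DirectSumMap.

Section PairMap.
Variables (K : fieldType) (A B A' B' : lmodType K).
Variables (f : {linear A -> A'}) (g : {linear B -> B'}).

Definition pair_map (u : A * B) : A' * B' := (f u.1, g u.2).

Fact pair_map_linear : linear pair_map.
Proof. by move=> k u v; rewrite /pair_map /= !linearP. Qed.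
HB.instance Definition _ :=
  GRing.isLinear.Build K (A * B)%type (A' * B')%type _ pair_map
    pair_map_linear.
End PairMap.

Definition gcast (K : fieldType) (T : Type) (M : T -> lmodType K) (x y : T)
  (e : x = y) (v : M x) : M y := ecast z (M z) e v.

Lemma gcast_dsum (K : fieldType) (T J : Type) (N : J -> T -> lmodType K)
    (x y : T) (e : x = y) (u : dsum (N^~ x)) j :
  (gcast (M := fun z => dsum (N^~ z)) e u : dsum (N^~ y)) j = gcast e (u j).
Proof. by case: _ / e. Qed.

Lemma gcast_pair (K : fieldType) (T : Type) (A B : T -> lmodType K) (x y : T)
    (e : x = y) (u : A x * B x) :
  gcast (M := fun z => (A z * B z)%type) e u = (gcast e u.1, gcast e u.2).
Proof. by case: _ / e; case: u. Qed.

Section Category.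
Variables (F : archiRealFieldType) (V : vectType F) (R : root_system V).
Variables (Pi : root_basis R) (K : fieldType).
Local Notation X := (weight R).
Local Notation simple_root := (simple_root Pi).

Fact shift0 (mu : X) (a : simple_root) : mu = mu + wt a *~ 0.
Proof. by rewrite mulr0z addr0. Qed.

Fact shiftC (mu : X) (a b : simple_root) (m n : int) :
  mu + wt b *~ n + wt a *~ m = mu + wt a *~ m + wt b *~ n.
Proof. exact: addrAC. Qed.

Fact shiftB (mu : X) (a : simple_root) (m n r : int) :
  mu + wt a *~ n + wt a *~ (m - r) = mu + wt a *~ m + wt a *~ (n - r).
Proof. by rewrite -!addrA -!mulrzDr addrCA. Qed.

(* X-graded spaces with operators E_{mu,a,n} and F_{mu,a,n}, n : int; those
   with n <= 0 carry no information, the last four fields fixing their value. *)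
Record opspace := OpSpace {
  wspace :> X -> lmodType K;
  opE : forall (mu : X) (a : simple_root) (n : int),
    {linear wspace mu -> wspace (mu + wt a *~ n)};
  opF : forall (mu : X) (a : simple_root) (n : int),
    {linear wspace (mu + wt a *~ n) -> wspace mu};
  opE_0 : forall mu a v, opE mu a 0 v = gcast (shift0 mu a) v;
  opF_0 : forall mu a v, opF mu a 0 v = gcast (esym (shift0 mu a)) v;
  opE_neg : forall mu a n v, n < 0 -> opE mu a n v = 0;
  opF_neg : forall mu a n v, n < 0 -> opF mu a n v = 0 }.

Definition has_dim (n : nat) (U : lmodType K) : Prop :=
  inhabited (Vector.axiom n U).

Section Conditions.
Variables (c : coefficients Pi K) (M : opspace).

Definition weights : set X := [set mu | exists v : M mu, v <> 0].

Definition axX1 : Prop :=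
  quasi_bounded Pi weights /\ forall mu, exists n, has_dim n (M mu).

(* All but finitely many terms of the sum over r vanish: c is 0 for r < 0 and
   the operators are 0 for r > m or r > n. *)
Definition axX2 : Prop :=
  (forall (mu : X) (a b : simple_root) (m n : nat), (0 < m)%N -> (0 < n)%N ->
    a != b -> forall v : M (mu + wt b *~ n),
      opE M mu a m (opF M mu b n v) =
      opF M (mu + wt a *~ m) b n
        (gcast (shiftC mu a b m n) (opE M (mu + wt b *~ n) a m v))) /\
  (forall (mu : X) (a : simple_root) (m n : nat), (0 < m)%N -> (0 < n)%N ->
    forall v : M (mu + wt a *~ n),
      opE M mu a m (opF M mu a n v) =
      \sum_(r \in [set: int]) c mu a m n r *:
        opF M (mu + wt a *~ m) a (n%:Z - r)
          (gcast (shiftB mu a m n r)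
             (opE M (mu + wt a *~ n) a (m%:Z - r) v))).

(* The pair (a, k) indexes the summand M_{mu + n a} with n = k + 1 > 0. *)
Definition dfamily (mu : X) (p : simple_root * nat) : lmodType K :=
  M (mu + wt p.1 *~ p.2.+1).
Definition dspace (mu : X) : lmodType K := dsum (dfamily mu).

(* E_mu is given by its components; under (X1) they form an element of
   [dspace mu]. *)
Definition dE (mu : X) (v : M mu) (p : simple_root * nat) : dfamily mu p :=
  opE M mu p.1 p.2.+1 v.
Definition dF (mu : X) (w : dspace mu) : M mu :=
  \sum_(p \in [set: simple_root * nat]) opF M mu p.1 p.2.+1 (w p).

Definition kerE (mu : X) : set (M mu) := [set v | forall p, dE v p = 0].
Definition imF (mu : X) : set (M mu) := range (@dF mu).

Definition axX3 : Prop := forall mu : X,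
  (forall v : M mu, exists u w, [/\ kerE u, imF w & v = u + w]) /\
  kerE (mu := mu) `&` imF (mu := mu) = [set 0].

End Conditions.

Record object (c : coefficients Pi K) := Object {
  obj_space :> opspace;
  obj_X1 : axX1 obj_space;
  obj_X2 : axX2 c obj_space;
  obj_X3 : axX3 obj_space }.

Record ophom (M N : opspace) := OpHom {
  hom_map :> forall mu : X, {linear M mu -> N mu};
  hom_E : forall mu a n (v : M mu),
    hom_map _ (opE M mu a n v) = opE N mu a n (hom_map mu v);
  hom_F : forall mu a n (v : M (mu + wt a *~ n)),
    hom_map mu (opF M mu a n v) = opF N mu a n (hom_map _ v) }.

Definition opiso (M N : opspace) : Prop :=
  exists (f : ophom M N) (g : ophom N M),
    forall mu, cancel (f mu) (g mu) /\ cancel (g mu) (f mu).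

Definition is_zero (M : opspace) : Prop := forall mu (v : M mu), v = 0.

Section BigSum.
Variables (J : Type) (N : J -> opspace).
Definition bsum_space (mu : X) : lmodType K := dsum (fun j => N j mu).
Definition bsumE mu a n :
  {linear bsum_space mu -> bsum_space (mu + wt a *~ n)} :=
  dsum_map (fun j => opE (N j) mu a n).
Definition bsumF mu a n :
  {linear bsum_space (mu + wt a *~ n) -> bsum_space mu} :=
  dsum_map (fun j => opF (N j) mu a n).

Fact bsumE_0 mu a v :
  bsumE mu a 0 v = gcast (M := bsum_space) (shift0 mu a) v.
Proof.
by apply: dsumP => j; rewrite (gcast_dsum (N := fun j => N j)) /= opE_0.
Qed.
Fact bsumF_0 mu a v :
  bsumF mu a 0 v = gcast (M := bsum_space) (esym (shift0 mu a)) v.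
Proof.
by apply: dsumP => j; rewrite (gcast_dsum (N := fun j => N j)) /= opF_0.
Qed.
Fact bsumE_neg mu a n v : n < 0 -> bsumE mu a n v = 0.
Proof. by move=> h; apply: dsumP => j /=; rewrite opE_neg. Qed.
Fact bsumF_neg mu a n v : n < 0 -> bsumF mu a n v = 0.
Proof. by move=> h; apply: dsumP => j /=; rewrite opF_neg. Qed.

Definition bsum : opspace := OpSpace bsumE_0 bsumF_0 bsumE_neg bsumF_neg.
End BigSum.

Section BinarySum.
Variables A B : opspace.
Definition sum2_space (mu : X) : lmodType K := (A mu * B mu)%type.
Definition sum2E mu a n :
  {linear sum2_space mu -> sum2_space (mu + wt a *~ n)} :=
  pair_map (opE A mu a n) (opE B mu a n).
Definition sum2F mu a n :
  {linear sum2_space (mu + wt a *~ n) -> sum2_space mu} :=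
  pair_map (opF A mu a n) (opF B mu a n).

Fact sum2E_0 mu a v :
  sum2E mu a 0 v = gcast (M := sum2_space) (shift0 mu a) v.
Proof. by rewrite gcast_pair /= /pair_map !opE_0. Qed.
Fact sum2F_0 mu a v :
  sum2F mu a 0 v = gcast (M := sum2_space) (esym (shift0 mu a)) v.
Proof. by rewrite gcast_pair /= /pair_map !opF_0. Qed.
Fact sum2E_neg mu a n v : n < 0 -> sum2E mu a n v = 0.
Proof. by move=> h; rewrite /= /pair_map !opE_neg. Qed.
Fact sum2F_neg mu a n v : n < 0 -> sum2F mu a n v = 0.
Proof. by move=> h; rewrite /= /pair_map !opF_neg. Qed.

Definition sum2 : opspace := OpSpace sum2E_0 sum2F_0 sum2E_neg sum2F_neg.
End BinarySum.

Variable c : coefficients Pi K.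

Definition indecomposable (M : object c) : Prop :=
  ~ is_zero M /\
  forall A B : object c, opiso M (sum2 A B) -> is_zero A \/ is_zero B.

Definition is_S (la : X) (S : object c) : Prop :=
  [/\ indecomposable S,
      has_dim 1 (S la) &
      forall mu, weights S mu -> wle Pi mu la].

End Category.

(* Main.v *)
Require Import Defs.
From HB Require Import structures.
From mathcomp Require Import all_boot all_order all_algebra.
From mathcomp Require Import boolp classical_sets functions cardinality fsbigop.

Set Implicit Arguments.
Unset Strict Implicit.
Unset Printing Implicit Defensive.
Import GRing.Theory.
Local Open Scope ring_scope.

(** Call a vector of M_mu primitive if all E_(a,n) with n > 0 kill it, that is, if
it lies in ker E_mu. The proof shows that M is determined by its spaces of
primitive vectors: restriction to primitive vectors is a bijection from
Hom(M, N) onto the families of linear maps ker E_mu(M) -> ker E_mu(N), mu in X,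
taken with no compatibility at all. The category is thus equivalent to that of
X-graded spaces, finite dimensional in each degree and of quasi-bounded
support, and S(la) is the object whose primitive vectors form a line in weight
la; all claims then become statements about dimensions.

Why restriction is injective ([hom_ext]): by (X3) and induction from above on
weights, which quasi-boundedness makes well-founded ([quasi_bounded_ind]), the
primitive vectors generate M under the F-operators ([gen_kerE]).

Why it is surjective ([lift_hom]): let g map primitive vectors to primitive
vectors, and let the graph be the F-stable subspace of M + N generated by the
pairs (p, g p). By (X2) it is also E-stable ([gen_E]), and it is total since M
is generated by primitive vectors. If it contains (0, y), then y is in the image
of F by (X3) for M, and E y = 0 by induction from above, so y = 0 by (X3) for N
([graph_functional0]). Hence the graph is that of a morphism. In particular
two objects are isomorphic once their spaces of primitive vectors have equal
dimensions ([lift_iso]).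

Why S(la) exists: let every weight space be the space of all functions on words
in letters (a, n), let E_(a,n) strip the letter (a, n), and define F by
recursion on words so that (X2) holds by definition ([cofree_X2]). A function
killed by all E is supported on the empty word, while a function in the image of
F vanishes there; so (X3) holds in the subspace generated by the function
supported on the empty word, placed in weight la ([S_primitive]).

Direct sums of the S(la) realise every family of dimensions of quasi-bounded
support ([bsum_realize]), which gives the decomposition of an arbitrary object,
the number of summands S(mu) being the dimension of ker E_mu ([fibre_size]). An
indecomposable object with highest weight la and one-dimensional top splits off
S(la), hence has the same primitive vectors as S(la) ([is_S_primitive]). *)

(** * The order on weights and induction from above *)

Section WeightOrder.
Variables (F : archiRealFieldType) (V : vectType F) (R : root_system V).
Variable Pi : root_basis R.
Local Notation X := (weight R).
Local Open Scope classical_set_scope.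

(** The linear form with value 1 on every simple root: it recovers the number
    of summands in a sum of simple roots. *)
Definition height (v : V) : F := \sum_i coord (in_tuple (simple Pi)) i v.

Lemma heightD : {morph height : u v / u + v}.
Proof.
move=> u v; rewrite /height -big_split /=; apply: eq_bigr => i _.
exact: linearD.
Qed.

Lemma height_wt (a : simple_root Pi) : height (val (wt a)) = 1.
Proof.
have /andP[_ hf] := simple_basis Pi.
have ha : val a \in simple Pi by exact: valP.
rewrite /height /= -(nth_index 0 ha).
have hi : (index (val a) (simple Pi) < size (simple Pi))%N by rewrite index_mem.
rewrite (bigD1 (Ordinal hi)) //= big1 => [|j hj].
  by rewrite (coord_free (Ordinal hi) (Ordinal hi)) ?eqxx ?addr0.
by rewrite (coord_free (Ordinal hi) j) // eq_sym (negbTE hj).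
Qed.

Lemma height_sum (s : seq (simple_root Pi)) :
  height (val (\sum_(a <- s) wt a)) = (size s)%:R.
Proof.
elim: s => [|a s IH].
  by rewrite big_nil raddf0 /height big1 // => i _; rewrite linear0.
rewrite big_cons raddfD /= heightD IH -natr1 addrC; congr (_ + _).
exact: height_wt.
Qed.

Lemma size_root_sum (s t : seq (simple_root Pi)) :
  \sum_(a <- s) wt a = \sum_(a <- t) wt a -> size s = size t.
Proof.
move=> /(congr1 (fun x => height (val x))); rewrite !height_sum => /eqP.
by rewrite Num.Theory.eqr_nat => /eqP.
Qed.

Lemma wle_refl (mu : X) : wle Pi mu mu.
Proof. by exists [::]; rewrite big_nil subrr. Qed.

Lemma wle_trans (nu mu la : X) : wle Pi mu nu -> wle Pi nu la -> wle Pi mu la.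
Proof.
move=> [s hs] [t ht]; exists (s ++ t).
by rewrite big_cat /= -hs -ht addrC addrA subrK.
Qed.

Lemma wt_mulz_sum (a : simple_root Pi) (n : nat) :
  wt a *~ n = \sum_(b <- nseq n a) wt b.
Proof. by rewrite big_nseq -Monoid.iteropE. Qed.

Lemma wle_shift (mu : X) (a : simple_root Pi) (n : nat) :
  wle Pi mu (mu + wt a *~ n).
Proof. by exists (nseq n a); rewrite addrC addKr wt_mulz_sum. Qed.

(** A weight in the interval is mu plus a sum of at most height (la - mu)
    simple roots, and there are finitely many such sums. *)
Lemma finite_interval (mu la : X) :
  finite_set [set nu | wle Pi mu nu /\ wle Pi nu la].
Proof.
have [[n hn]|h] := pselect (wle Pi mu la); last first.
  apply: sub_finite_set (finite_set0 _) => nu [h1 h2].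
  by apply: h; apply: wle_trans h1 h2.
pose f (s : (size n).-bseq (simple_root Pi)) := mu + \sum_(a <- s) wt a.
apply: (@sub_finite_set _ _ (f @` [set: _])) => [nu [[s hs] [t ht]]|].
  have hsize : (size s <= size n)%N.
    have -> : size n = size (s ++ t).
      by apply: size_root_sum; rewrite big_cat /= -hn -hs -ht [RHS]addrC addrA subrK.
    by rewrite size_cat leq_addr.
  by exists (Bseq hsize) => //; rewrite /f /= -hs addrC subrK.
by apply: finite_image; apply: finite_finset.
Qed.

Lemma quasi_bounded_sub (T U : set X) :
  T `<=` U -> quasi_bounded Pi U -> quasi_bounded Pi T.
Proof.
by move=> h hU mu; apply: sub_finite_set (hU mu) => nu [/h h1 h2].
Qed.

Lemma quasi_bounded_down (T : set X) : quasi_bounded Pi T ->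
  quasi_bounded Pi [set nu | exists2 la, T la & wle Pi nu la].
Proof.
move=> hT mu.
apply: (sub_finite_set _ (bigcup_finite (hT mu)
  (fun la _ => finite_interval mu la))) => nu [[la Tla h1] h2].
by exists la => //; split => //; apply: wle_trans h2 h1.
Qed.

Lemma quasi_bounded1 (la : X) : quasi_bounded Pi [set la].
Proof. by move=> mu; apply: sub_finite_set (finite_set1 la) => nu []. Qed.

Lemma quasi_bounded_height (T : set X) (mu : X) : quasi_bounded Pi T ->
  exists N, forall la s, T la -> la - mu = \sum_(a <- s) wt a ->
    (size (s : seq (simple_root Pi)) < N)%N.
Proof.
move=> /(_ mu) /finite_seqP[l hl].
have [N hN] : exists N, forall la s, la \in l -> la - mu = \sum_(a <- s) wt a ->
    (size (s : seq (simple_root Pi)) < N)%N.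
  elim: l {hl} => [|la l [N IH]]; first by exists 0%N.
  have [[s hs]|hn] := pselect (wle Pi mu la).
    exists (maxn (size s).+1 N) => nu t; rewrite inE => /orP[/eqP->|h] ht.
      by rewrite (@size_root_sum t s) ?leq_maxl // -hs.
    by rewrite leq_max (IH nu) // orbT.
  exists N => nu t; rewrite inE => /orP[/eqP->|h] ht; last exact: IH h ht.
  by case: hn; exists t.
exists N => la s hT hs; apply: hN (hs).
have : [set la | T la /\ wle Pi mu la] la by split=> //; exists s.
by rewrite hl.
Qed.

(** Only finitely many weights of T lie above mu, so their heights over mu are
    bounded; passing from mu to mu + n a lowers that bound, until no weight of
    T is left above. *)
Lemma quasi_bounded_ind (T : set X) (Q : X -> Prop) : quasi_bounded Pi T ->
  (forall mu, (forall nu, T nu -> ~ wle Pi mu nu) -> Q mu) ->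
  (forall mu, (forall (a : simple_root Pi) (k : nat), Q (mu + wt a *~ k.+1)) ->
     Q mu) ->
  forall mu, Q mu.
Proof.
move=> hT h0 hS mu; have [N] := quasi_bounded_height mu hT.
elim: N mu => [|N IH] mu hN.
  by apply: h0 => nu hnu [s hs]; have := hN _ _ hnu hs.
apply: hS => a k; apply: IH => la s hla hs.
have := hN la (nseq k.+1 a ++ s) hla; rewrite size_cat size_nseq ltnS.
move=> h; apply: leq_trans (h _); first by rewrite addSn ltnS leq_addl.
by rewrite big_cat -hs -wt_mulz_sum opprD [RHS]addrC addrA subrK.
Qed.

End WeightOrder.

(** * Finite families in a module *)

Section OfLinear.
Variables (K : fieldType) (A B : lmodType K) (f : A -> B).

(** A linear map can thus be built from a function and a proof in the middle of
    another proof, where no structure can be declared. *)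
Definition of_linear (h : linear f) : A -> B := let _ := h in f.
HB.instance Definition _ (h : linear f) :=
  GRing.isLinear.Build K A B _ (of_linear h) h.
End OfLinear.

Section Families.
Variables (K : fieldType) (L : lmodType K).
Implicit Types (U : L -> Prop).

Definition subspace U := U 0 /\ forall k u v, U u -> U v -> U (k *: u + v).

Lemma subspaceZ U k u : subspace U -> U u -> U (k *: u).
Proof. by move=> [h0 h] hu; rewrite -[_ *: _]addr0; apply: h. Qed.

Lemma subspaceD U u v : subspace U -> U u -> U v -> U (u + v).
Proof. by move=> [h0 h] hu hv; rewrite -[u]scale1r; apply: h. Qed.

Lemma subspace_sum U (I : Type) (r : seq I) (P : pred I) (f : I -> L) :
  subspace U -> (forall i, P i -> U (f i)) -> U (\sum_(i <- r | P i) f i).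
Proof.
move=> hU h; apply: big_ind => //; first by case: hU.
by move=> u v; apply: subspaceD.
Qed.

Definition indep n (b : 'I_n -> L) :=
  forall a : 'I_n -> K, \sum_i a i *: b i = 0 -> forall i, a i = 0.

Definition spans U n (b : 'I_n -> L) :=
  forall u, U u -> exists a : 'I_n -> K, u = \sum_i a i *: b i.

Definition is_basis U n (b : 'I_n -> L) :=
  [/\ forall i, U (b i), indep b & spans U b].

(** Coordinates of b' in terms of b form an n x m matrix, which would have a
    nonzero row kernel if m < n. *)
Lemma indep_le U m n (b : 'I_m -> L) (b' : 'I_n -> L) :
  spans U b -> (forall i, U (b' i)) -> indep b' -> (n <= m)%N.
Proof.
move=> hs hU hi.
have /choice[a ha] : forall i, exists a : 'I_m -> K, b' i = \sum_j a j *: b j.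
  by move=> i; apply: hs.
pose A := \matrix_(i < n, j < m) a i j.
rewrite leqNgt; apply/negP => hmn.
have : kermx A != 0.
  by rewrite -mxrank_eq0 mxrank_ker -lt0n subn_gt0 (leq_ltn_trans (rank_leq_col A)).
case/rowV0Pn => v /sub_kermxP hv /eqP[]; apply/rowP => i; rewrite mxE.
apply: (hi (fun i => v 0 i)).
under eq_bigr do rewrite ha scaler_sumr.
rewrite exchange_big /= big1 // => j _.
under eq_bigr do rewrite scalerA.
rewrite -scaler_suml; have /rowP/(_ j) := hv; rewrite !mxE.
by under eq_bigr do rewrite mxE; move=> ->; rewrite scale0r.
Qed.

(** An independent family in U of maximal size is a basis of U. *)
Lemma ex_basis U m (b : 'I_m -> L) : subspace U -> spans U b ->
  exists d (b' : 'I_d -> L), is_basis U b'.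
Proof.
move=> hU hs.
pose P d := `[< exists b' : 'I_d -> L, (forall i, U (b' i)) /\ indep b' >].
have P0 : exists d, P d.
  by exists 0%N; apply/asboolP; exists (fun=> 0); split=> [[]//|a _ []//].
have Pm d : P d -> (d <= m)%N.
  by move=> /asboolP[b' [h1 h2]]; exact: indep_le hs h1 h2.
case: (ex_maxnP P0 Pm) => d /asboolP[b' [hb' hi]] hmax.
exists d, b'; split=> // u hu; apply: contrapT => hn.
(* If u is not in the span of b', adding it keeps the family independent. *)
pose b1 (i : 'I_d.+1) := oapp b' u (unlift ord0 i).
have : P d.+1.
  apply/asboolP; exists b1; split=> [i|a].
    by rewrite /b1; case: unliftP => [j _|_] //=; apply: hb'.
  rewrite big_ord_recl /b1 unlift_none /=.
  under eq_bigr do rewrite liftK /=.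
  have [a0|a0] := eqVneq (a ord0) 0.
    rewrite a0 scale0r add0r => /hi h i.
    by have [j ->|->] := unliftP ord0 i.
  move=> /(congr1 (fun x => (a ord0)^-1 *: x)).
  rewrite scaler0 scalerDr scalerA mulVf // scale1r => /eqP.
  rewrite addr_eq0 => /eqP e; case: hn.
  exists (fun i => - ((a ord0)^-1 * a (lift ord0 i))).
  rewrite e scaler_sumr -sumrN; apply: eq_bigr => i _.
  by rewrite scalerA scaleNr.
by move=> /hmax; rewrite ltnn.
Qed.

Lemma basis_size U m n (b : 'I_m -> L) (b' : 'I_n -> L) :
  is_basis U b -> is_basis U b' -> m = n.
Proof.
move=> [h1 h2 h3] [h1' h2' h3']; apply/eqP; rewrite eqn_leq.
by rewrite (indep_le h3' h1 h2) (indep_le h3 h1' h2').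
Qed.

Lemma indep_inj n (b : 'I_n -> L) a a' : indep b ->
  \sum_i a i *: b i = \sum_i a' i *: b i -> a =1 a'.
Proof.
move=> h /eqP; rewrite -subr_eq0 -sumrB => /eqP e i; apply/eqP.
rewrite -subr_eq0; apply/eqP; apply: (h (fun i => a i - a' i)).
by rewrite -[RHS]e; apply: eq_bigr => j _; rewrite scalerBl.
Qed.

Lemma basis_has_dim n (b : 'I_n -> L) :
  is_basis (fun=> True) b -> has_dim n L.
Proof.
move=> [_ hi hs].
have /choice[a ha] : forall u, exists a : 'I_n -> K, u = \sum_i a i *: b i.
  by move=> u; apply: hs.
split; exists (fun u => \row_i a u i).
  move=> k u v; apply/rowP => i; rewrite !mxE.
  apply: (indep_inj hi (a' := fun i => k * a u i + a v i)).
  rewrite -ha [in LHS](ha u) [in LHS](ha v) scaler_sumr -big_split /=.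
  by apply: eq_bigr => j _; rewrite scalerA scalerDl.
exists (fun r : 'rV[K]_n => \sum_i r 0 i *: b i) => [u|r].
  by rewrite [RHS]ha; apply: eq_bigr => i _; rewrite mxE.
by apply/rowP => i; rewrite mxE; apply: (indep_inj hi); rewrite -ha.
Qed.

Lemma spans_has_dim m (b : 'I_m -> L) :
  spans (fun=> True) b -> exists n, has_dim n L.
Proof.
move=> hb; have [|d [b' hb']] := ex_basis (U := fun=> True) _ hb => //.
by exists d; apply: basis_has_dim hb'.
Qed.

Lemma has_dim_spans n : has_dim n L ->
  exists b : 'I_n -> L, is_basis (fun=> True) b.
Proof.
case=> -[f lf [g fK gK]].
have lg : forall k u v, g (k *: u + v) = k *: g u + g v.
  by move=> k u v; rewrite -[RHS]fK lf !gK.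
have gs (a : 'I_n -> K) : g (\row_i a i) = \sum_i a i *: g (delta_mx 0 i).
  rewrite -/(of_linear lg (\row_i a i)) [\row_i a i]row_sum_delta linear_sum.
  by apply: eq_bigr => i _; rewrite linearZ mxE.
exists (fun i => g (delta_mx 0 i)); split=> //.
  move=> a; rewrite -gs -(linear0 (of_linear lg)) => /(can_inj gK)/rowP h i.
  by have := h i; rewrite !mxE.
move=> u _; exists (fun i => f u 0 i); rewrite -gs -[LHS]fK; congr g.
by apply/rowP => i; rewrite mxE.
Qed.

End Families.

(** * Direct sums *)

Section DirectSumInjection.
Variables (K : fieldType) (J : Type) (N : J -> lmodType K).
Local Open Scope classical_set_scope.

Definition single j (x : N j) (i : J) : N i :=
  if pselect (j = i) is left e then ecast i (N i) e x else 0.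

Lemma single_same j (x : N j) : single x j = x.
Proof. by rewrite /single; case: pselect => // e; rewrite (Prop_irrelevance e erefl). Qed.

Lemma single_neq j (x : N j) i : j <> i -> single x i = 0.
Proof. by rewrite /single; case: pselect. Qed.

Fact dinj_finite j (x : N j) : finite_set [set i | single x i <> 0].
Proof.
apply: sub_finite_set (finite_set1 j) => i /= h.
by apply: contrapT => hn; apply: h; apply: single_neq => e; apply: hn.
Qed.
Definition dinj j (x : N j) : dsum N := Dsum (dinj_finite x).

Lemma dinj_linear j : linear (@dinj j).
Proof.
move=> k u v; apply: dsumP => i /=.
have [e|ne] := pselect (j = i); last by rewrite !single_neq // scaler0 addr0.
by case: _ / e; rewrite !single_same.
Qed.
HB.instance Definition _ j :=
  GRing.isLinear.Build K (N j) (dsum N) _ (@dinj j) (@dinj_linear j).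

Lemma dsum_sumE (I : Type) (r : seq I) (P : pred I) (f : I -> dsum N) j :
  (\sum_(i <- r | P i) f i : dsum N) j = \sum_(i <- r | P i) (f i : dsum N) j.
Proof. exact: (big_morph (fun u : dsum N => u j)). Qed.

End DirectSumInjection.

Section DirectSumSupport.
Variables (K : fieldType) (J : eqType) (N : J -> lmodType K).
Local Open Scope classical_set_scope.

Lemma dsum_sum_single (l : seq J) (u : dsum N) :
  uniq l -> (forall j, u j <> 0 -> j \in l) ->
  u = \sum_(j <- l) dinj (u j).
Proof.
move=> hl h; apply: dsumP => i; rewrite dsum_sumE.
have [hi|hi] := boolP (i \in l).
  rewrite (bigD1_seq i) //= single_same big1 ?addr0 // => j /eqP ne.
  by rewrite single_neq.
rewrite big_seq big1 => [|j hj].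
  by apply: contrapT => /h; apply/negP.
by rewrite /= single_neq // => e; move: hi; rewrite -e hj.
Qed.

Lemma dsum_support (u : dsum N) : exists l : seq J,
  uniq l /\ forall j, u j <> 0 -> j \in l.
Proof.
have /finite_seqP[l hl] := dsum_finite u.
exists (undup l); split; first exact: undup_uniq.
move=> j hj; rewrite mem_undup.
by have : [set j | u j <> 0] j by []; rewrite hl.
Qed.

End DirectSumSupport.

(** * Spaces with operators: kernels, images, generation *)

Section Operators.
Variables (F : archiRealFieldType) (V : vectType F) (R : root_system V).
Variables (Pi : root_basis R) (K : fieldType).
Local Notation X := (weight R).
Local Notation simple_root := (simple_root Pi).
Local Notation opspace := (opspace Pi K).
Local Open Scope classical_set_scope.

Section OneSpace.
Variable M : opspace.

Lemma kerEP mu (v : M mu) :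
  kerE v <-> forall a (k : nat), opE M mu a k.+1 v = 0.
Proof. by split=> [h a k|h [a k]]; [exact: (h (a, k))|exact: h]. Qed.

Lemma kerE_subspace mu : subspace (kerE (M := M) (mu := mu)).
Proof.
split=> [|k u v /kerEP hu /kerEP hv]; apply/kerEP => a n.
  by rewrite linear0.
by rewrite linearP hu hv scaler0 addr0.
Qed.

Lemma dF_sum mu (l : seq (simple_root * nat)) (w : dspace M mu) :
  uniq l -> (forall p, w p <> 0 -> p \in l) ->
  dF w = \sum_(p <- l) opF M mu p.1 p.2.+1 (w p).
Proof.
move=> hl h; rewrite /dF (fsbigE l) //.
  by apply: eq_bigl => p; rewrite in_setT.
move=> p _ hp; have -> : w p = 0; last by rewrite linear0.
by apply: contrapT => /h; apply/negP.
Qed.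

Lemma dF_linear mu : linear (@dF _ _ _ _ _ M mu).
Proof.
move=> k u v.
have [l [hl h]] := dsum_support u; have [l' [hl' h']] := dsum_support v.
have hm p : u p <> 0 \/ v p <> 0 -> p \in undup (l ++ l' : seq (simple_root * nat)).
  by rewrite mem_undup mem_cat; move=> [/h ->|/h' ->]; rewrite ?orbT.
rewrite !(dF_sum (undup_uniq (l ++ l'))).
- rewrite scaler_sumr -big_split /=; apply: eq_bigr => p _.
  by rewrite linearP.
- by move=> p hp; apply: hm; right.
- by move=> p hp; apply: hm; left.
move=> p /= hp; apply: hm; have [e|] := pselect (u p = 0); last by left.
by right=> e'; apply: hp; rewrite e e' scaler0 addr0.
Qed.

Lemma imF_subspace mu : subspace (imF (M := M) (mu := mu)).
Proof.
split; first by exists 0 => //; rewrite -(linear0 (of_linear (@dF_linear mu))).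
by move=> k _ _ [u _ <-] [v _ <-]; exists (k *: u + v) => //; rewrite dF_linear.
Qed.

Lemma imF_opF mu a (k : nat) v : imF (opF M mu a k.+1 v).
Proof.
exists (dinj (v : dfamily M mu (a, k))) => //.
rewrite (@dF_sum _ [:: (a, k)]) //.
  by rewrite big_seq1 /= single_same.
move=> p /= hp; rewrite inE; apply/eqP; apply: contrapT => ne; apply: hp.
by rewrite single_neq // => e; apply: ne.
Qed.

(** Hides the infinite direct sum behind imF: together with [imF_subspace] and
    [imF_opF] this is the form in which the image of F is used. *)
Lemma imF_ind mu (U : M mu -> Prop) : subspace U ->
  (forall a (k : nat) v, U (opF M mu a k.+1 v)) -> forall v, imF v -> U v.
Proof.
move=> hU h _ [w _ <-]; have [l [hl hw]] := dsum_support w.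
by rewrite (dF_sum hl hw); apply: subspace_sum.
Qed.

End OneSpace.

(** The terms with r < 0 vanish as the coefficients do, and those with r > m as
    E_(a,m-r) = 0. *)
Lemma X2_sum (c : coefficients Pi K) (M : opspace) mu a (m n : nat)
    (v : M (mu + wt a *~ n)) :
  \sum_(r \in [set: int]) c mu a m n r *: opF M (mu + wt a *~ m) a (n%:Z - r)
    (gcast (shiftB mu a m n r) (opE M (mu + wt a *~ n) a (m%:Z - r) v)) =
  \sum_(r < m.+1) c mu a m n r *: opF M (mu + wt a *~ m) a (n%:Z - r%:Z)
    (gcast (shiftB mu a m n r) (opE M (mu + wt a *~ n) a (m%:Z - r%:Z) v)).
Proof.
rewrite (fsbigE [seq Posz r | r <- iota 0 m.+1]) //.
- rewrite big_map -[iota 0 m.+1]/(index_iota 0 m.+1) big_mkord.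
  by apply: eq_bigl => r; rewrite in_setT.
- by rewrite map_inj_uniq ?iota_uniq // => i j [].
move=> [r|r] _ hr; last by rewrite coef_neg ?scale0r.
have hmr : (m < r)%N.
  rewrite ltnNge; apply: contra hr => hr.
  by apply/mapP; exists r => //; rewrite mem_iota add0n ltnS.
rewrite opE_neg; last by rewrite Num.Theory.subr_lt0 ltz_nat.
suff -> : gcast (shiftB mu a m n r) (0 : M _) = 0 by rewrite linear0 scaler0.
by case: _ / (shiftB _ _ _ _ _).
Qed.

(** An inductive predicate, because [gen_E] and [hom_ext] go by induction on
    the way in which a vector is obtained. *)
Inductive generated (M : opspace) (G : forall mu, M mu -> Prop) :
    forall mu, M mu -> Prop :=
| gen_incl mu (v : M mu) : G mu v -> generated G v
| gen_0 mu : generated G (0 : M mu)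
| gen_lin mu k (u v : M mu) : generated G u -> generated G v -> generated G (k *: u + v)
| gen_opF mu a (k : nat) (v : M (mu + wt a *~ k.+1)) :
    generated G v -> generated G (opF M mu a k.+1 v).

Section Generation.
Variables (M : opspace) (G : forall mu, M mu -> Prop).

Lemma gen_subspace mu : subspace (@generated M G mu).
Proof. by split; [exact: gen_0|exact: gen_lin]. Qed.

Lemma gen_cast mu nu (e : mu = nu) (v : M mu) : generated G v -> generated G (gcast e v).
Proof. by case: _ / e. Qed.

Lemma gen_F mu a n (v : M (mu + wt a *~ n)) : generated G v -> generated G (opF M mu a n v).
Proof.
case: n v => [[|k] v hv|k v hv]; last by rewrite opF_neg //; apply: gen_0.
  by rewrite opF_0; apply: gen_cast.
exact: gen_opF.
Qed.

(** By induction on the construction of v: (X2) writes E F x as a combination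
    of vectors F E x, and E x is generated by the induction hypothesis. *)
Lemma gen_E (c : coefficients Pi K) mu (v : M mu) : axX2 c M ->
  (forall mu (v : M mu), G v -> kerE v) -> generated G v ->
  forall a n, generated G (opE M mu a n v).
Proof.
move=> [hne heq] hG; elim=> {mu v} [mu v hv|mu|mu k u v _ hu _ hv|mu b k v hv IH] a n.
- case: n => [[|n]|n]; last by rewrite opE_neg //; apply: gen_0.
    by rewrite opE_0; apply: gen_cast; apply: gen_incl.
  by have /kerEP -> := hG _ _ hv; apply: gen_0.
- by rewrite linear0; apply: gen_0.
- by rewrite linearP; apply: gen_lin.
case: n => [[|n]|n]; last by rewrite opE_neg //; apply: gen_0.
  by rewrite opE_0; apply: gen_cast; apply: gen_opF.
have [e|ne] := eqVneq a b; last first.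
  by rewrite hne //; apply: gen_F; apply: gen_cast.
case: _ / e v hv IH => v hv IH.
rewrite heq // X2_sum; apply: subspace_sum; first exact: gen_subspace.
move=> r _; apply: subspaceZ; first exact: gen_subspace.
by apply: gen_F; apply: gen_cast.
Qed.

End Generation.

(** By (X3) a vector of weight mu is a primitive vector plus images of vectors
    of higher weight. *)
Lemma gen_kerE (M : opspace) : quasi_bounded Pi (weights M) -> axX3 M ->
  forall mu (v : M mu), generated (fun mu => kerE (M := M) (mu := mu)) v.
Proof.
move=> hb h3; apply: (quasi_bounded_ind hb) => mu h v.
  have -> : v = 0; last exact: gen_0.
  apply: contrapT => hv; apply: (h mu); last exact: wle_refl.
  by exists v.
have [hsplit _] := h3 mu; have [u [w [hu hw ->]]] := hsplit v.
apply: subspaceD; [exact: gen_subspace|exact: gen_incl|].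
apply: (imF_ind _ _ hw); first exact: gen_subspace.
by move=> a k x; apply: gen_opF.
Qed.

Lemma X3_eq0 (M : opspace) mu (v : M mu) : axX3 M -> kerE v -> imF v -> v = 0.
Proof.
by move=> /(_ mu)[_ h] hk hi; have : [set 0] v by rewrite -h.
Qed.

Lemma sum2_X2 (c : coefficients Pi K) (M N : opspace) :
  axX2 c M -> axX2 c N -> axX2 c (sum2 M N).
Proof.
move=> [h1 h2] [h1' h2']; split=> mu a => [b m n hm hn hab [x y]|m n hm hn [x y]].
  by rewrite /= /pair_map /= h1 // h1' // gcast_pair.
rewrite X2_sum /= /pair_map /= h2 // h2' // !X2_sum.
rewrite [RHS]surjective_pairing; congr pair.
  by rewrite (big_morph fst (id1 := 0) (op1 := +%R)) //; apply: eq_bigr => r _; rewrite gcast_pair.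
by rewrite (big_morph snd (id1 := 0) (op1 := +%R)) //; apply: eq_bigr => r _; rewrite gcast_pair.
Qed.

End Operators.

(** * Extending maps from the primitive vectors *)

Section Lifting.
Variables (F : archiRealFieldType) (V : vectType F) (R : root_system V).
Variables (Pi : root_basis R) (K : fieldType) (c : coefficients Pi K).
Local Notation X := (weight R).
Local Notation simple_root := (simple_root Pi).
Local Notation opspace := (opspace Pi K).
Local Open Scope classical_set_scope.

Lemma hom_kerE (M N : opspace) (f : ophom M N) mu (v : M mu) :
  kerE v -> kerE (f mu v).
Proof. by move=> /kerEP h; apply/kerEP => a k; rewrite -hom_E h linear0. Qed.

(** Both sides are linear and commute with the F-operators, and primitive
    vectors generate M. *)
Lemma hom_ext (M N : opspace) (f : ophom M N) (k : K) (g : ophom M N) :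
  quasi_bounded Pi (weights M) -> axX3 M ->
  (forall mu (v : M mu), kerE v -> f mu v = k *: g mu v) ->
  forall mu (v : M mu), f mu v = k *: g mu v.
Proof.
move=> hb h3 h mu v; elim: (gen_kerE hb h3 v) => {mu v} [//|mu|mu l u v _ hu _ hv|mu a n v _ hv].
- by rewrite !linear0 ?scaler0.
- by rewrite !linearP hu hv !scalerA mulrC.
by rewrite !hom_F hv linearZ.
Qed.

Definition hom_id (M : opspace) : ophom M M.
Proof. by exists (fun mu => idfun : {linear M mu -> M mu}). Defined.

Definition hom_comp (L M N : opspace) (g : ophom M N) (f : ophom L M) : ophom L N.
Proof.
exists (fun mu => (g mu \o f mu : {linear L mu -> N mu})).
  by move=> mu a n v /=; rewrite !hom_E.
by move=> mu a n v /=; rewrite !hom_F.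
Defined.

(** The axioms of an object but for finite dimensional weight spaces, which
    follow when the kernels of E are finite dimensional (see
    [preobject_fin_dim]). *)
Definition preobject (M : opspace) :=
  [/\ axX2 c M, axX3 M & quasi_bounded Pi (weights M)].

Section Graph.
Variables (M N : opspace) (g : forall mu, M mu -> N mu).
Hypotheses (preM : preobject M) (preN : preobject N).
Hypothesis g_kerE : forall mu (v : M mu), kerE v -> kerE (g v).
Hypothesis g_lin : forall mu k (u v : M mu), kerE u -> kerE v ->
  g (k *: u + v) = k *: g u + g v.

Definition graph0 mu (z : sum2 M N mu) := kerE z.1 /\ z.2 = g z.1.
(** The graph of the wanted extension of g, as a subspace of M + N. *)
Definition graph mu (x : M mu) (y : N mu) :=
  generated graph0 ((x, y) : sum2 M N mu).

Lemma g_eq0 mu : g (0 : M mu) = 0.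
Proof.
have [h _] := kerE_subspace M mu.
by have := g_lin (-1) h h; rewrite scaler0 addr0 scaleN1r addNr.
Qed.

Lemma graph_E mu x y a n : @graph mu x y ->
  graph (opE M mu a n x) (opE N mu a n y).
Proof.
move=> h; have [hM _ _] := preM; have [hN _ _] := preN.
apply: (@gen_E _ _ _ _ _ (sum2 M N) graph0 c mu (x, y) (sum2_X2 hM hN)) => //.
move=> nu [u v] [/= hu ->]; apply/kerEP => b k.
have /kerEP h1 := hu; have /kerEP h2 := g_kerE hu.
by rewrite /= /pair_map /= h1 h2.
Qed.

(** Applying F adds elements of the image of F in both components; modulo these
    images only the pairs (p, g p) remain. *)
Lemma graph_split mu x y : @graph mu x y ->
  exists p, [/\ kerE p, imF (x - p) & imF (y - g p)].
Proof.
suff h (z : sum2 M N mu) : generated graph0 z ->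
    exists p, [/\ kerE p, imF (z.1 - p) & imF (z.2 - g p)] by apply: h.
have hiM mu' := imF_subspace M mu'; have hiN mu' := imF_subspace N mu'.
have hk mu' := kerE_subspace M mu'.
elim=> {mu z x y} [mu z [h1 h2]|mu|mu k z z' _ [p [h1 h2 h3]] _ [p' [h1' h2' h3']]|mu a k z _ _].
- by exists z.1; rewrite h2 !subrr; split=> //; [case: (hiM mu)|case: (hiN mu)].
- exists 0; rewrite g_eq0 /= !subr0.
  by split; [case: (hk mu)|case: (hiM mu)|case: (hiN mu)].
- exists (k *: p + p'); split; first by case: (hk mu) => _; apply.
    have -> : (k *: z + z').1 - (k *: p + p') = k *: (z.1 - p) + (z'.1 - p').
      by rewrite /= scalerBr opprD addrACA.
    by case: (hiM mu) => _; apply.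
  have -> : (k *: z + z').2 - g (k *: p + p') = k *: (z.2 - g p) + (z'.2 - g p').
    by rewrite g_lin //= scalerBr opprD addrACA.
  by case: (hiN mu) => _; apply.
exists 0; rewrite g_eq0 !subr0; split; first by case: (hk mu).
  exact: imF_opF.
exact: imF_opF.
Qed.

(** The element y is in the image of F by [graph_split], where (X3) for M
    forces p = 0; and E y = 0 by the induction hypothesis, since (0, E y) is in
    the graph. *)
Lemma graph_functional0 mu y : @graph mu 0 y -> y = 0.
Proof.
have [_ h3M _] := preM; have [_ h3N hb] := preN.
move: mu y; apply: (quasi_bounded_ind hb) => mu h y hy.
  apply: contrapT => ne; apply: (h mu); last exact: wle_refl.
  by exists y.
have [p [hp hx hyp]] := graph_split hy.
have p0 : p = 0.
  apply: X3_eq0 h3M hp _.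
  have -> : p = -1 *: (0 - p) by rewrite scaleN1r sub0r opprK.
  by apply: subspaceZ hx; apply: imF_subspace.
move: hyp; rewrite p0 g_eq0 subr0 => hi.
apply: X3_eq0 h3N _ hi; apply/kerEP => a k; apply: h.
by have := graph_E a k.+1 hy; rewrite linear0.
Qed.

Lemma graph_total mu (x : M mu) : exists y, graph x y.
Proof.
have [_ h3 hb] := preM.
elim: (gen_kerE hb h3 x) => {mu x} [mu v hv|mu|mu k u v _ [y hy] _ [y' hy']|mu a k v _ [y hy]].
- by exists (g v); apply: gen_incl.
- by exists 0; apply: gen_0.
- by exists (k *: y + y'); apply: (gen_lin k hy hy').
by exists (opF N mu a k.+1 y); apply: (gen_opF hy).
Qed.

Lemma graph_functional mu (x : M mu) y y' : graph x y -> graph x y' -> y = y'.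
Proof.
move=> h h'; apply/eqP; rewrite -subr_eq0; apply/eqP.
apply: (@graph_functional0 mu).
have hz : (0, y - y') = -1 *: ((x, y') : sum2 M N mu) + ((x, y) : sum2 M N mu).
  by congr pair; rewrite /= scaleN1r ?addNr // addrC.
by rewrite /graph hz; apply: gen_lin.
Qed.

(** The graph is total and functional, and stable under E and F. *)
Lemma lift_hom : exists f : ophom M N, forall mu (v : M mu), kerE v -> f mu v = g v.
Proof.
pose f mu := projT1 (choice (@graph_total mu)).
have fP mu x : graph x (f mu x) by exact: (projT2 (choice (@graph_total mu))).
have fu mu (x : M mu) y : graph x y -> f mu x = y by exact: graph_functional.
have fl mu : linear (f mu).
  by move=> k u v; apply: fu; apply: (gen_lin k (fP mu u) (fP mu v)).
have fE mu a n (v : M mu) : f _ (opE M mu a n v) = opE N mu a n (f mu v).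
  by apply: fu; apply: graph_E.
have fF mu a n (v : M (mu + wt a *~ n)) : f _ (opF M mu a n v) = opF N mu a n (f _ v).
  by apply: fu; apply: (gen_F (fP _ v)).
exists (@OpHom _ _ _ _ _ M N (fun mu => of_linear (fl mu)) fE fF) => mu v hv /=.
by apply: fu; apply: gen_incl.
Qed.

End Graph.

(** The multiplicity of S(mu) in M is the number d for which this holds. *)
Definition kerE_dim (M : opspace) mu d :=
  exists b : 'I_d -> M mu, is_basis (kerE (M := M) (mu := mu)) b.

Lemma kerE_dim_opiso (M N : opspace) mu d :
  opiso M N -> kerE_dim M mu d -> kerE_dim N mu d.
Proof.
move=> [f [g h]] [b [h1 h2 h3]]; have [fK gK] := h mu.
exists (fun i => f mu (b i)); split=> [i|a|u hu]; first exact: hom_kerE.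
  move=> e; apply: h2; apply: (can_inj fK); rewrite linear0 -[RHS]e linear_sum.
  by apply: eq_bigr => i _; rewrite linearZ.
have [a e] := h3 _ (hom_kerE g hu); exists a.
by rewrite -[LHS]gK e linear_sum; apply: eq_bigr => i _; rewrite linearZ.
Qed.

(** Total functions that are linear on the kernels, rather than maps between
    subtypes: this is the form in which [lift_hom] takes its data. *)
Lemma basis_transfer (M N : opspace) mu d : kerE_dim M mu d -> kerE_dim N mu d ->
  exists g : (M mu -> N mu) * (N mu -> M mu),
  [/\ forall v, kerE v -> kerE (g.1 v),
      forall k u v, kerE u -> kerE v -> g.1 (k *: u + v) = k *: g.1 u + g.1 v,
      forall v, kerE v -> g.2 (g.1 v) = v &
    [/\ forall v, kerE v -> kerE (g.2 v),
      forall k u v, kerE u -> kerE v -> g.2 (k *: u + v) = k *: g.2 u + g.2 v &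
      forall v, kerE v -> g.1 (g.2 v) = v]].
Proof.
move=> [b [h1 h2 h3]] [b' [h1' h2' h3']].
have ex (O : opspace) (e : 'I_d -> O mu) : is_basis (kerE (M := O) (mu := mu)) e ->
    exists co : O mu -> 'I_d -> K, forall v, kerE v -> v = \sum_i co v i *: e i.
  move=> [_ _ h].
  have /choice[co hco] v : exists co : 'I_d -> K, kerE v -> v = \sum_i co i *: e i.
    have [hv|hv] := pselect (kerE v); last by exists (fun=> 0).
    by have [a ha] := h v hv; exists a.
  by exists co.
have key (O O' : opspace) (e : 'I_d -> O mu) (e' : 'I_d -> O' mu) co :
    is_basis (kerE (M := O) (mu := mu)) e -> is_basis (kerE (M := O') (mu := mu)) e' ->
    (forall v, kerE v -> v = \sum_i co v i *: e i) ->
    [/\ forall v, kerE (\sum_i co v i *: e' i),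
      forall k u v, kerE u -> kerE v -> \sum_i co (k *: u + v) i *: e' i =
        k *: (\sum_i co u i *: e' i) + \sum_i co v i *: e' i &
      forall a, kerE (\sum_i a i *: e i) -> co (\sum_i a i *: e i) =1 a].
  move=> [k1 k2 k3] [k1' k2' k3'] hco; split.
  - move=> v; apply: subspace_sum; first exact: kerE_subspace.
    by move=> i _; apply: subspaceZ (kerE_subspace O' mu) (k1' i).
  - move=> k u v hu hv; rewrite scaler_sumr -big_split /=.
    apply: eq_bigr => i _; rewrite scalerA -scalerDl; congr (_ *: _).
    apply: (indep_inj (a' := fun i => k * co u i + co v i) k2).
    have huv : kerE (k *: u + v) by apply: (proj2 (kerE_subspace O mu)).
    rewrite -hco //.
    rewrite [in LHS](hco _ hu) [in LHS](hco _ hv) scaler_sumr -big_split /=.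
    by apply: eq_bigr => j _; rewrite scalerA scalerDl.
  by move=> a ha; apply: (indep_inj k2); rewrite -hco.
have hb : is_basis (kerE (M := M) (mu := mu)) b by [].
have hb' : is_basis (kerE (M := N) (mu := mu)) b' by [].
have [co hco] := ex _ _ hb; have [co' hco'] := ex _ _ hb'.
have [q1 q2 q3] := key _ _ _ _ _ hb hb' hco.
have [q1' q2' q3'] := key _ _ _ _ _ hb' hb hco'.
exists (fun v => \sum_i co v i *: b' i, fun v => \sum_i co' v i *: b i).
split=> //= [v hv|].
  by rewrite [RHS]hco //; apply: eq_bigr => i _; rewrite q3'.
split=> // v hv.
by rewrite [RHS]hco' //; apply: eq_bigr => i _; rewrite q3.
Qed.

(** Extend mutually inverse maps between the kernels; on primitive vectors both
    composites of the extensions are the identity, hence everywhere. *)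
Lemma lift_iso (M N : opspace) : preobject M -> preobject N ->
  (forall mu, exists d, kerE_dim M mu d /\ kerE_dim N mu d) -> opiso M N.
Proof.
move=> hM hN hd.
have ex mu : exists g : (M mu -> N mu) * (N mu -> M mu), _ :=
  let: ex_intro d (conj h h') := hd mu in basis_transfer h h'.
pose g mu := projT1 (cid (ex mu)).
have gP mu := projT2 (cid (ex mu)).
have [f hf] : exists f : ophom M N, forall mu (v : M mu), kerE v -> f mu v = (g mu).1 v.
  by apply: lift_hom => // mu; have [] := gP mu.
have [f' hf'] : exists f : ophom N M, forall mu (v : N mu), kerE v -> f mu v = (g mu).2 v.
  by apply: lift_hom => // mu; have [_ _ _ []] := gP mu.
have [_ h3 hb] := hM; have [_ h3' hb'] := hN.
exists f, f' => mu; split=> v.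
  rewrite -[RHS]scale1r -[LHS]/(hom_comp f' f mu v) -[X in _ *: X]/(hom_id M mu v).
  apply: hom_ext => // nu u hu; rewrite /= scale1r hf // hf'.
    by have [_ _ ->] := gP nu.
  by have [h _ _ _] := gP nu; apply: h.
rewrite -[RHS]scale1r -[LHS]/(hom_comp f f' mu v) -[X in _ *: X]/(hom_id N mu v).
apply: hom_ext => // nu u hu; rewrite /= scale1r hf' // hf.
  by have [_ _ _ [_ _ ->]] := gP nu.
by have [_ _ _ [h _ _]] := gP nu; apply: h.
Qed.

End Lifting.

(** * Sums of spaces with operators *)

Section Sums.
Variables (F : archiRealFieldType) (V : vectType F) (R : root_system V).
Variables (Pi : root_basis R) (K : fieldType) (c : coefficients Pi K).
Local Notation X := (weight R).
Local Notation simple_root := (simple_root Pi).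
Local Notation opspace := (opspace Pi K).
Local Open Scope classical_set_scope.

Lemma imF_hom (M N : opspace) (f : ophom M N) mu (v : M mu) :
  imF v -> imF (f mu v).
Proof.
apply: (imF_ind (U := fun v => imF (f mu v))); last first.
  by move=> a k u; rewrite hom_F; apply: imF_opF.
split=> [|k u w hu hw]; first by rewrite linear0; case: (imF_subspace N mu).
by rewrite linearP; apply: (proj2 (imF_subspace N mu)).
Qed.

Section Binary.
Variables A B : opspace.

Definition sum2_fst : ophom (sum2 A B) A.
Proof. by exists (fun mu => fst : {linear sum2 A B mu -> A mu}). Defined.

Definition sum2_snd : ophom (sum2 A B) B.
Proof. by exists (fun mu => snd : {linear sum2 A B mu -> B mu}). Defined.

Lemma sum2_inl_linear mu : linear (fun x : A mu => (x, 0) : sum2 A B mu).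
Proof. by move=> k u v; congr pair; rewrite /= scaler0 addr0. Qed.

Lemma sum2_inr_linear mu : linear (fun x : B mu => (0, x) : sum2 A B mu).
Proof. by move=> k u v; congr pair; rewrite /= scaler0 addr0. Qed.

Definition sum2_inl : ophom A (sum2 A B).
Proof.
exists (fun mu => of_linear (@sum2_inl_linear mu)) => mu a n v.
  by rewrite /= /pair_map /of_linear /= linear0.
by rewrite /= /pair_map /of_linear /= linear0.
Defined.

Definition sum2_inr : ophom B (sum2 A B).
Proof.
exists (fun mu => of_linear (@sum2_inr_linear mu)) => mu a n v.
  by rewrite /= /pair_map /of_linear /= linear0.
by rewrite /= /pair_map /of_linear /= linear0.
Defined.

Lemma sum2_split mu (z : sum2 A B mu) :
  z = sum2_inl mu z.1 + sum2_inr mu z.2.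
Proof. by case: z => x y; congr pair; rewrite /= ?addr0 ?add0r. Qed.

Lemma sum2_X3 : axX3 A -> axX3 B -> axX3 (sum2 A B).
Proof.
move=> hA hB mu; split.
  case=> x y; have [[hx _] [hy _]] := (hA mu, hB mu).
  have [u [w [hu hw ->]]] := hx x; have [u' [w' [hu' hw' ->]]] := hy y.
  exists (sum2_inl mu u + sum2_inr mu u'), (sum2_inl mu w + sum2_inr mu w'); split.
  - by apply: (subspaceD (kerE_subspace (sum2 A B) mu)); exact: hom_kerE.
  - by apply: (subspaceD (imF_subspace (sum2 A B) mu)); exact: imF_hom.
  by congr pair; rewrite /= ?addr0 ?add0r.
apply/seteqP; split=> [z [hk hi]|_ ->]; last first.
  by split; [case: (kerE_subspace (sum2 A B) mu)|case: (imF_subspace (sum2 A B) mu)].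
rewrite /= [z]surjective_pairing; congr pair.
  exact: X3_eq0 hA (hom_kerE sum2_fst hk) (imF_hom sum2_fst hi).
exact: X3_eq0 hB (hom_kerE sum2_snd hk) (imF_hom sum2_snd hi).
Qed.

Lemma sum2_quasi_bounded : quasi_bounded Pi (weights A) ->
  quasi_bounded Pi (weights B) -> quasi_bounded Pi (weights (sum2 A B)).
Proof.
move=> hA hB mu.
have : finite_set ([set la | weights A la /\ wle Pi mu la] `|`
                   [set la | weights B la /\ wle Pi mu la]).
  by rewrite finite_setU; split; [exact: hA|exact: hB].
apply: sub_finite_set => la [[[x y] h] hl].
have [x0|x0] := pselect (x = 0); last by left; split=> //; exists x.
by right; split=> //; exists y => y0; apply: h; rewrite x0 y0.
Qed.

Lemma sum2_preobject : preobject c A -> preobject c B -> preobject c (sum2 A B).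
Proof.
move=> [h1 h2 h3] [h1' h2' h3']; split; first exact: sum2_X2.
  exact: sum2_X3.
exact: sum2_quasi_bounded.
Qed.

Lemma sum2_kerE_dim mu m n : kerE_dim A mu m -> kerE_dim B mu n ->
  kerE_dim (sum2 A B) mu (m + n).
Proof.
move=> [b [h1 h2 h3]] [b' [h1' h2' h3']].
pose e (i : 'I_(m + n)) := match fintype.split i with
  | inl j => sum2_inl mu (b j) | inr j => sum2_inr mu (b' j) end.
have sumE a : \sum_i a i *: e i =
    ((\sum_i a (lshift n i) *: b i, \sum_i a (rshift m i) *: b' i) : sum2 A B mu).
  rewrite big_split_ord /= [RHS]sum2_split !linear_sum; congr (_ + _).
    apply: eq_bigr => i _; rewrite /e; case: splitP => j hj; last first.
      by have := ltn_ord i; rewrite /= in hj; rewrite hj ltnNge leq_addr.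
    by rewrite linearZ; congr (_ *: sum2_inl mu (b _)); apply/val_inj.
  apply: eq_bigr => i _; rewrite /e; case: splitP => j hj.
    by have := ltn_ord j; rewrite -hj ltnNge /= leq_addr.
  rewrite linearZ; congr (_ *: sum2_inr mu (b' _)); apply/val_inj.
  by move: hj => /= /addnI.
exists e; split=> [i|a|[x y] hxy].
- by rewrite /e; case: fintype.split => j; exact: hom_kerE.
- rewrite sumE => -[/h2 hx /h2' hy] i; rewrite -[i]splitK.
  by case: fintype.split => j /=; [exact: hx|exact: hy].
have [a ha] := h3 _ (hom_kerE sum2_fst hxy).
have [a' ha'] := h3' _ (hom_kerE sum2_snd hxy).
exists (fun i => match fintype.split i with inl j => a j | inr j => a' j end).
rewrite sumE; congr pair; rewrite /= in ha ha'.
  by rewrite ha; apply: eq_bigr => i _; rewrite -[lshift n i]/(unsplit (inl i)) unsplitK.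
by rewrite ha'; apply: eq_bigr => i _; rewrite -[rshift m i]/(unsplit (inr i)) unsplitK.
Qed.

End Binary.

Section Arbitrary.
Variables (J : Type) (N : J -> opspace).

Lemma dsum_eval_linear j mu : linear (fun v : bsum N mu => v j : N j mu).
Proof. by []. Qed.

Definition bsum_proj j : ophom (bsum N) (N j).
Proof. by exists (fun mu => of_linear (@dsum_eval_linear j mu)). Defined.

Lemma dsum_inj_linear j mu :
  linear (fun x : N j mu => dinj (N := fun j => N j mu) x : bsum N mu).
Proof. by move=> k u v; apply: (@dinj_linear K J (fun j => N j mu) j k u v). Qed.

Definition bsum_inj j : ophom (N j) (bsum N).
Proof.
exists (fun mu => of_linear (@dsum_inj_linear j mu)).
  move=> mu a n v; apply: dsumP => i /=.
  have [e|ne] := pselect (j = i); last by rewrite !single_neq // linear0.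
  by case: _ / e; rewrite !single_same.
move=> mu a n v; apply: dsumP => i /=.
have [e|ne] := pselect (j = i); last by rewrite !single_neq // linear0.
by case: _ / e; rewrite !single_same.
Defined.

Lemma bsum_X2 : (forall j, axX2 c (N j)) -> axX2 c (bsum N).
Proof.
move=> h; split=> mu a => [b m n hm hn hab v|m n hm hn v].
  apply: dsumP => j /=; have [h1 _] := h j; rewrite h1 //.
  by rewrite (gcast_dsum (N := fun j => N j)).
rewrite X2_sum; apply: dsumP => j; have [_ h2] := h j.
rewrite /= h2 // X2_sum dsum_sumE; apply: eq_bigr => r _.
by rewrite /= (gcast_dsum (N := fun j => N j)).
Qed.

Lemma bsum_kerE mu (v : bsum N mu) : kerE v <-> forall j, kerE (v j : N j mu).
Proof.
split=> [h j|h]; first exact: (hom_kerE (bsum_proj j) h).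
by apply/kerEP => a k; apply: dsumP => j; have /kerEP := h j => /(_ a k).
Qed.

(** Split each component by (X3); where the component is zero both parts are
    zero, so both parts are again finitely supported. *)
Lemma bsum_X3 : (forall j, axX3 (N j)) -> axX3 (bsum N).
Proof.
move=> h mu; split.
  move=> v.
  have ex j : exists z : N j mu * N j mu,
      [/\ kerE z.1, imF z.2 & v j = z.1 + z.2].
    have [hs _] := h j mu; have [u [w [h1 h2 h3]]] := hs (v j).
    by exists (u, w).
  pose u j := (sval (cid (ex j))).1; pose w j := (sval (cid (ex j))).2.
  have uwP j : [/\ kerE (u j), imF (w j) & v j = u j + w j] := svalP (cid (ex j)).
  have u0 j : v j = 0 -> u j = 0.
    move=> e; have [h1 h2 h3] := uwP j; apply: X3_eq0 (h j) h1 _.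
    have -> : u j = -1 *: w j.
      by apply/eqP; rewrite scaleN1r -addr_eq0 -h3 e.
    exact: subspaceZ (imF_subspace _ _) h2.
  have w0 j : v j = 0 -> w j = 0.
    by move=> e; have [_ _] := uwP j; rewrite e u0 // add0r.
  have fu : finite_set [set j | u j <> 0].
    by apply: sub_finite_set (dsum_finite v) => j /= hj e; apply: hj; apply: u0.
  have fw : finite_set [set j | w j <> 0].
    by apply: sub_finite_set (dsum_finite v) => j /= hj e; apply: hj; apply: w0.
  exists (Dsum fu), (Dsum fw); split.
  - by apply/bsum_kerE => j; have [] := uwP j.
  - have [l [hl hw]] := @dsum_support K {classic J} (fun j => N j mu) (Dsum fw).
    rewrite (@dsum_sum_single K {classic J} (fun j => N j mu) l (Dsum fw) hl hw).
    apply: subspace_sum; first exact: imF_subspace.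
    by move=> j _; have [_ hj _] := uwP j; apply: (imF_hom (bsum_inj j) hj).
  by apply: dsumP => j /=; have [] := uwP j.
apply/seteqP; split=> [v [hk hi]|_ ->]; last first.
  by split; [case: (kerE_subspace (bsum N) mu)|case: (imF_subspace (bsum N) mu)].
apply: dsumP => j.
exact: X3_eq0 (h j) (hom_kerE (bsum_proj j) hk) (imF_hom (bsum_proj j) hi).
Qed.

End Arbitrary.

(** Up to isomorphism this characterises S(la) among preobjects (see
    [primitive_unique]). The boolean is read as the dimension 1 or 0. *)
Definition primitive_at la (S : opspace) := forall mu, kerE_dim S mu (mu == la).

Lemma primitive_vector la (S : opspace) mu : primitive_at la S -> exists q : S mu, la = mu ->
  [/\ kerE q, forall k, k *: q = 0 -> k = 0 & forall u, kerE u -> exists k, u = k *: q].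
Proof.
move=> /(_ mu) h; have [e|ne] := pselect (la = mu); last by exists 0.
move: h; rewrite e eqxx => -[b [h1 h2 h3]]; exists (b ord0) => _; split=> //.
  by move=> k hk; apply: (h2 (fun=> k) _ ord0); rewrite big_ord_recl big_ord0 addr0.
by move=> u /h3[a ->]; exists (a ord0); rewrite big_ord_recl big_ord0 addr0.
Qed.

Lemma kerE_dim0_eq0 (S : opspace) mu : kerE_dim S mu 0 -> forall u : S mu, kerE u -> u = 0.
Proof. by move=> [b [_ _ h]] u /h[a ->]; rewrite big_ord0. Qed.

Section Isotypic.
Variables (J : eqType) (N : J -> opspace) (w : J -> X).
Hypothesis hN : forall j, primitive_at (w j) (N j).

(** The vectors are the primitive vectors of the summands S(mu) listed in l. A
    possibly incomplete list is allowed in order to bound the number of such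
    summands by the dimension of ker E_mu. *)
Lemma bsum_indep mu (l : seq J) : uniq l -> (forall j, j \in l -> w j = mu) ->
  exists b : 'I_(size l) -> bsum N mu, [/\ forall i, kerE (b i), indep b &
    (forall j, w j = mu -> j \in l) -> spans (kerE (M := bsum N) (mu := mu)) b].
Proof.
move=> hl hw.
pose q j := sval (cid (primitive_vector mu (hN j))).
have qP j : w j = mu -> [/\ kerE (q j), forall k, k *: q j = 0 -> k = 0 &
    forall u, kerE u -> exists k, u = k *: q j] := svalP (cid (primitive_vector mu (hN j))).
pose t := tnth (in_tuple l).
have ht i : w (t i) = mu by apply: hw; apply: mem_tnth.
have tinj i i' : i != i' -> t i <> t i'.
  by move=> /eqP ne e; apply: ne; apply: (tuple_uniqP (in_tuple l) hl).
exists (fun i => bsum_inj N (t i) mu (q (t i))); split.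
- by move=> i; apply: hom_kerE; have [] := qP _ (ht i).
- move=> a h i.
  have [_ hq _] := qP _ (ht i); apply: hq.
  have := congr1 (fun u : bsum N mu => u (t i)) h.
  rewrite dsum_sumE (bigD1 i) //= single_same big1 ?addr0 // => i' hi.
  by rewrite single_neq ?scaler0 //; apply: tinj.
move=> hfull u hu.
have hk i : exists k, u (t i) = k *: q (t i).
  by have [_ _] := qP _ (ht i); apply; apply: (proj1 (bsum_kerE u) hu).
exists (fun i => sval (cid (hk i))).
rewrite [LHS](dsum_sum_single hl); last first.
  move=> j hj; apply: contrapT => hjl; apply: hj.
  apply: (kerE_dim0_eq0 _ (proj1 (bsum_kerE u) hu j)).
  have := hN j mu; suff -> : (mu == w j) = false by [].
  by apply/eqP => e; apply: hjl; apply: hfull.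
rewrite big_tnth; apply: eq_bigr => i _; rewrite -linearZ /=.
by congr dinj; rewrite -[LHS]/(u (t i)); exact: (svalP (cid (hk i))).
Qed.

Lemma bsum_kerE_dim mu (l : seq J) : uniq l -> (forall j, (j \in l) <-> w j = mu) ->
  kerE_dim (bsum N) mu (size l).
Proof.
move=> hl hw; have [b [h1 h2 h3]] := bsum_indep hl (fun j => proj1 (hw j)).
by exists b; split=> //; apply: h3 => j /hw.
Qed.

End Isotypic.

End Sums.

(** * Subspaces stable under the operators *)

Section Submodule.
Variables (K : fieldType) (L : lmodType K).

(** Bundled, so that the subtype below can carry a module structure that
    depends on the proof of stability. *)
Record submodule := Submodule { sub_pred :> L -> Prop; subP : subspace sub_pred }.

Variable U : submodule.
Definition in_submodule : {pred L} := fun x => `[< U x >].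

Fact in_submodule_closed : submod_closed in_submodule.
Proof.
have [h0 h] := subP U; split; first exact/asboolP.
by move=> k u v /asboolP hu /asboolP hv; apply/asboolP; apply: h.
Qed.
HB.instance Definition _ :=
  GRing.isSubmodClosed.Build K L in_submodule in_submodule_closed.

Record submodule_type := Subtype { sub_val : L; _ : sub_val \in in_submodule }.
HB.instance Definition _ := [isSub for sub_val].
HB.instance Definition _ := [Choice of submodule_type by <:].
HB.instance Definition _ := [SubChoice_isSubZmodule of submodule_type by <:].
HB.instance Definition _ := [SubZmodule_isSubLmodule of submodule_type by <:].
End Submodule.

Section Simple.
Variables (F : archiRealFieldType) (V : vectType F) (R : root_system V).
Variables (Pi : root_basis R) (K : fieldType) (c : coefficients Pi K).
Local Notation X := (weight R).
Local Notation simple_root := (simple_root Pi).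
Local Notation opspace := (opspace Pi K).
Local Open Scope classical_set_scope.

Section SubOpspace.
Variables (M : opspace) (U : forall mu, submodule (M mu)).
Hypothesis UE : forall mu a n (v : M mu), U mu v -> U _ (opE M mu a n v).
Hypothesis UF : forall mu a n (v : M (mu + wt a *~ n)),
  U _ v -> U mu (opF M mu a n v).

Definition sub_space mu : lmodType K := submodule_type (U mu).

Lemma sub_valP mu (v : sub_space mu) : U mu (val v).
Proof. exact/asboolP/(valP v). Qed.

Definition sub_mk mu (v : M mu) (h : U mu v) : sub_space mu :=
  Subtype (introT (asboolP _) h : v \in in_submodule (U mu)).

Definition sub_opE mu a n (v : sub_space mu) : sub_space (mu + wt a *~ n) :=
  sub_mk (UE a n (sub_valP v)).
Definition sub_opF mu a n (v : sub_space (mu + wt a *~ n)) : sub_space mu :=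
  sub_mk (UF (sub_valP v)).

Lemma sub_opE_linear mu a n : linear (@sub_opE mu a n).
Proof. by move=> k u v; apply: val_inj; rewrite /= linearP. Qed.
Lemma sub_opF_linear mu a n : linear (@sub_opF mu a n).
Proof. by move=> k u v; apply: val_inj; rewrite /= linearP. Qed.

Lemma val_gcast mu nu (e : mu = nu) (v : sub_space mu) :
  val (gcast (M := sub_space) e v) = gcast e (val v).
Proof. by case: _ / e. Qed.

Definition subopspace : opspace.
Proof.
apply: (@OpSpace _ _ _ _ _ sub_space (fun mu a n => of_linear (@sub_opE_linear mu a n))
  (fun mu a n => of_linear (@sub_opF_linear mu a n))).
- by move=> mu a v; apply: val_inj; rewrite val_gcast /= opE_0.
- by move=> mu a v; apply: val_inj; rewrite val_gcast /= opF_0.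
- by move=> mu a n v hn; apply: val_inj; rewrite /= opE_neg.
by move=> mu a n v hn; apply: val_inj; rewrite /= opF_neg.
Defined.

Lemma sub_val_linear mu : linear (fun v : subopspace mu => val v : M mu).
Proof. by []. Qed.

Definition sub_hom : ophom subopspace M.
Proof. by exists (fun mu => of_linear (@sub_val_linear mu)). Defined.

Lemma sub_val_gcast mu nu (e : mu = nu) (v : subopspace mu) :
  sub_val (gcast (M := subopspace) e v) = gcast e (sub_val v).
Proof. by case: _ / e. Qed.

Lemma subopspace_X2 : axX2 c M -> axX2 c subopspace.
Proof.
move=> [h1 h2]; split=> mu a => [b m n hm hn hab v|m n hm hn v].
  by apply: val_inj; rewrite /= h1 // sub_val_gcast.
rewrite X2_sum; apply: val_inj; rewrite /= h2 // X2_sum.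
rewrite -[RHS]/(of_linear (@sub_val_linear _) _) linear_sum; apply: eq_bigr => r _.
rewrite linearZ; congr (_ *: _).
by rewrite /= {1}/of_linear /= sub_val_gcast.
Qed.

End SubOpspace.

(** * The objects S(la) inside a cofree space *)

(** The letter (a, k) stands for the operator with index n = k + 1. *)
Definition word := seq (simple_root * nat).

(** The operator E_(a,n); n = 0 gives the identity. *)
Definition strip a (n : nat) (h : word -> K^o) : word -> K^o :=
  if n is k.+1 then fun u => h ((a, k) :: u) else h.

(** The operator F_(a,m) into weight mu, with m = 0 giving the identity. Its
    value on a word that starts with (b, k) is dictated by (X2), since
    stripping that letter is E_(b,k+1): either F and E commute, or E F is the
    sum over r, of which the terms with r > m vanish because F_(a,m-r) = 0. On
    the empty word the value is 0, so that the image of F meets the functions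
    supported on the empty word in 0. *)
Fixpoint lower (a : simple_root) (m : nat) (mu : X) (h : word -> K^o) (u : word) : K^o :=
  if m is 0 then h u else
  match u with
  | [::] => 0
  | (b, k) :: u' =>
      if a == b then \sum_(r < k.+2) c mu a k.+1 m r *
        (if (r <= m)%N then
           lower a (m - r) (mu + wt a *~ k.+1) (strip a (k.+1 - r) h) u' else 0)
      else lower a m (mu + wt b *~ k.+1) (fun v => h ((b, k) :: v)) u'
  end.

Lemma lower0 a mu h : lower a 0 mu h = h.
Proof. by apply: funext => -[|[b k] u]. Qed.

Lemma strip_linear a n : linear (strip a n).
Proof. by case: n. Qed.

Lemma lower_linear a m mu : linear (lower a m mu).
Proof.
move=> k h h'; apply: funext => u; rewrite -[RHS]/(k * lower a m mu h u + lower a m mu h' u).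
elim: u m mu h h' => [|[b n] u IH] [|m] mu h h' //=; first by rewrite mulr0 addr0.
case: ifP => _; last exact: IH.
rewrite mulr_sumr -big_split /=; apply: eq_bigr => r _.
rewrite strip_linear; case: ifP => _; last by rewrite !mulr0 addr0.
by rewrite IH mulrDr; congr (_ + _); rewrite mulrCA.
Qed.

Definition cofreeE (mu : X) a (n : int) : {linear (word -> K^o) -> (word -> K^o)} :=
  if n is Posz n then of_linear (@strip_linear a n) else \0.
Definition cofreeF (mu : X) a (n : int) : {linear (word -> K^o) -> (word -> K^o)} :=
  if n is Posz n then of_linear (@lower_linear a n mu) else \0.

(** The same space in every weight, so that no compatibility between words and
    weights has to be recorded. *)
Definition cofree_space (mu : X) : lmodType K := (word -> K^o).

Lemma gcast_cofree mu nu (e : mu = nu) (h : cofree_space mu) :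
  gcast (M := cofree_space) e h = h.
Proof. by case: _ / e. Qed.

Definition cofree : opspace.
Proof.
apply: (@OpSpace _ _ _ _ _ cofree_space cofreeE cofreeF).
- by move=> mu a v; rewrite gcast_cofree.
- by move=> mu a v; rewrite gcast_cofree /= /of_linear lower0.
- by move=> mu a [].
by move=> mu a [].
Defined.

Lemma cofree_X2 : axX2 c cofree.
Proof.
split=> mu a => [b m n hm hn hab v|m n hm hn v].
  rewrite [gcast _ _]gcast_cofree /= /of_linear.
  case: m n hm hn v => [//|m] [//|n] _ _ v; apply: funext => u /=.
  by rewrite eq_sym (negbTE hab).
rewrite X2_sum; case: m n hm hn v => [//|m] [//|n] _ _ v.
apply: funext => u; rewrite fct_sumE /= /of_linear /= eqxx.
apply: eq_bigr => r _; rewrite [gcast _ _]gcast_cofree.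
rewrite -[RHS]/(c mu a m.+1 n.+1 r * _ u); congr (_ * _).
have hr : (r <= m.+1)%N by rewrite -ltnS.
rewrite (subzn hr).
case: leqP => hrn; first by rewrite (subzn hrn).
have hneg : (n.+1%:Z - r%:Z < 0) by rewrite Num.Theory.subr_lt0 ltz_nat.
by case: (n.+1%:Z - r%:Z) hneg.
Qed.

Section Highest.
Variable la : X.

(** Every E_(a,n) with n > 0 kills it: it is the primitive generator of S(la).
    *)
Definition highest_vector : word -> K^o := fun u => (u == [::])%:R.

Definition top_vector mu (v : cofree mu) : Prop := mu = la /\ v = highest_vector.

Lemma top_vector_kerE mu (v : cofree mu) : top_vector v -> kerE v.
Proof. by move=> [_ ->]; apply/kerEP => a k; apply: funext. Qed.

Definition top_submodule mu := Submodule (@gen_subspace _ _ _ _ _ cofree top_vector mu).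

(** Stable under E by [gen_E], as its generator is primitive in the cofree
    space. *)
Definition S_opspace : opspace :=
  @subopspace cofree top_submodule
   (fun mu a n v hv => gen_E cofree_X2 top_vector_kerE hv a n)
   (fun mu a n v hv => gen_F hv).

Lemma top_submodule_weight mu (v : cofree mu) : generated top_vector v -> v = 0 \/ wle Pi mu la.
Proof.
elim=> {mu v} [mu v [-> _]|mu|mu k u v _ [->|h] _ [->|h']|mu a k v _ [->|h]].
- by right; apply: wle_refl.
- by left.
- by left; rewrite scaler0 addr0.
- by right.
- by right.
- by right.
- by left; rewrite linear0.
by right; apply: wle_trans h; apply: wle_shift.
Qed.

Lemma S_weights mu : weights S_opspace mu -> wle Pi mu la.
Proof.
move=> [v hv]; have [h|//] := top_submodule_weight (sub_valP v).
by case: hv; apply: val_inj.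
Qed.

Lemma S_X2 : axX2 c S_opspace.
Proof. exact/subopspace_X2/cofree_X2. Qed.

(** Every nonempty word starts with a letter, and stripping it gives zero. *)
Lemma cofree_kerE mu (v : cofree mu) : kerE v -> v = v [::] *: (highest_vector : cofree mu).
Proof.
move=> /kerEP h; apply: funext => -[|[a k] u].
  by rewrite -[RHS]/(v [::] * _) mulr1.
transitivity (0 : K); first exact: (congr1 (fun f : word -> K^o => f u) (h a k)).
by rewrite -[RHS]/(v [::] * _) mulr0.
Qed.

Lemma cofree_imF mu (v : cofree mu) : imF v -> v [::] = 0.
Proof.
apply: (imF_ind (M := cofree) (U := fun v : word -> K^o => v [::] = 0)) => //.
split=> // k u w hu hw; rewrite -[LHS]/(k * u [::] + w [::]).
by rewrite hu hw mulr0 addr0.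
Qed.

Lemma cofree_kerE_imF mu (v : cofree mu) : kerE v -> imF v -> v = 0.
Proof. by move=> hk hi; rewrite (cofree_kerE hk) (cofree_imF hi) scale0r. Qed.

Lemma S_kerE mu (v : S_opspace mu) : kerE (M := cofree) (sub_val v) -> kerE v.
Proof. by move=> /kerEP h; apply/kerEP => a k; apply: val_inj; apply: h. Qed.

(** The part in ker E comes from multiples of the generator, which lives in
    weight la only; everything else is an image of F. *)
Lemma S_split mu (v : S_opspace mu) : exists u w : S_opspace mu,
  [/\ kerE u, mu <> la -> u = 0, imF w & v = u + w].
Proof.
have hk nu := kerE_subspace S_opspace nu.
have hi nu := imF_subspace S_opspace nu.
suff key nu (x : cofree nu) (h : generated top_vector x) : forall h' : top_submodule nu x,
    exists u w : S_opspace nu,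
    [/\ kerE u, nu <> la -> u = 0, imF w & sub_mk h' = u + w].
  have [u [w [h1 h2 h3 h4]]] := key _ _ (sub_valP v) (sub_valP v).
  by exists u, w; split=> //; rewrite -h4; apply: val_inj.
elim: h => {nu x} [nu x hx|nu|nu k x y hx IHx hy IHy|nu a k x hx _] h'.
- exists (sub_mk h'), 0; rewrite addr0; split=> //.
  + by apply: S_kerE; apply: top_vector_kerE.
  + by case: hx.
  by case: (hi nu).
- exists 0, 0; rewrite addr0; split=> //; last exact: val_inj.
    by case: (hk nu).
  by case: (hi nu).
- have [u [w [h1 h2 h3 h4]]] := IHx hx; have [u' [w' [h1' h2' h3' h4']]] := IHy hy.
  exists (k *: u + u'), (k *: w + w'); split.
  + by apply: (proj2 (hk nu)).
  + by move=> ne; rewrite h2 // h2' // scaler0 addr0.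
  + by apply: (proj2 (hi nu)).
  rewrite addrACA -scalerDr -h4 -h4'; exact: val_inj.
exists 0, (opF S_opspace nu a k.+1 (sub_mk (hx : top_submodule _ x))).
split=> //; first by case: (hk nu).
  exact: imF_opF.
by rewrite add0r; apply: val_inj.
Qed.

Lemma S_kerE_imF_eq0 mu (v : S_opspace mu) : kerE v -> imF v -> v = 0.
Proof.
move=> hk hi; apply: val_inj; apply: cofree_kerE_imF.
  exact: (hom_kerE (sub_hom _ _) hk).
exact: (imF_hom (sub_hom _ _) hi).
Qed.

Lemma S_X3 : axX3 S_opspace.
Proof.
move=> mu; split.
  by move=> v; have [u [w [h1 _ h3 h4]]] := S_split v; exists u, w.
apply/seteqP; split=> [v [hk hi]|_ ->]; first exact: S_kerE_imF_eq0.
by split; [case: (kerE_subspace S_opspace mu)|case: (imF_subspace S_opspace mu)].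
Qed.

Lemma S_preobject : preobject c S_opspace.
Proof.
split; [exact: S_X2|exact: S_X3|].
apply: quasi_bounded_sub (quasi_bounded_down (quasi_bounded1 Pi la)).
by move=> mu h; exists la => //; apply: S_weights.
Qed.

Lemma S_primitive : primitive_at la S_opspace.
Proof.
move=> mu; have [->|/eqP ne] := eqVneq mu la; last first.
  exists (fun=> 0); split=> [[]|a _ []|u hu] //.
  exists (fun=> 0); rewrite big_ord0.
  have [v [w [_ h2 h3 h4]]] := S_split u.
  by apply: S_kerE_imF_eq0 => //; rewrite h4 h2 // add0r.
have hv : top_submodule la highest_vector by apply: gen_incl.
exists (fun=> sub_mk hv); split=> [_|a|u hu].
- by apply: S_kerE; apply: top_vector_kerE.
- rewrite big_ord_recl big_ord0 addr0 => /(congr1 val) /=.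
  move=> /(congr1 (fun f : word -> K^o => f [::])).
  rewrite -[LHS]/(a ord0 * 1) mulr1 => h i; rewrite (ord1 i).
  exact: h.
have := cofree_kerE (hom_kerE (sub_hom _ _) hu).
set k := _ [::] => h; exists (fun=> k); rewrite big_ord_recl big_ord0 addr0.
exact: val_inj.
Qed.

End Highest.

(** * Finite dimensional weight spaces *)

Definition fin_dim (L : lmodType K) := exists n (b : 'I_n -> L), spans (fun=> True) b.

Lemma spans_finType (L : lmodType K) (I : finType) (b : I -> L) :
  (forall u, exists a : I -> K, u = \sum_i a i *: b i) -> fin_dim L.
Proof.
move=> h; exists #|I|, (b \o enum_val) => u _; have [a ->] := h u.
exists (a \o enum_val); rewrite (reindex (@enum_val I xpredT)) //=.
by apply: onW_bij; apply: enum_val_bij.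
Qed.

(** By induction from above: M_mu is spanned by ker E_mu and by the images of
    F_(a,n) on the spaces M_(mu + n a), almost all of which vanish. *)
Lemma preobject_fin_dim (M : opspace) : preobject c M ->
  (forall mu, exists d, kerE_dim M mu d) -> forall mu, fin_dim (M mu).
Proof.
move=> [_ h3 hb] hd; apply: (quasi_bounded_ind hb) => mu h.
  exists 0%N, (fun=> 0) => u _; exists (fun=> 0); rewrite big_ord0.
  apply: contrapT => hu; apply: (h mu); last exact: wle_refl.
  by exists u.
have [N hN] := quasi_bounded_height mu hb.
have [d [b [_ _ hbs]]] := hd mu.
pose P := (simple_root * 'I_N)%type.
have ex (p : P) : exists z : {n & 'I_n -> M (mu + wt p.1 *~ p.2.+1)},
    spans (fun=> True) (projT2 z).
  by have [n [e he]] := h p.1 p.2; exists (existT _ n e).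
pose n p := projT1 (sval (cid (ex p))).
pose e p : 'I_(n p) -> _ := projT2 (sval (cid (ex p))).
have eP p : spans (fun=> True) (e p) := svalP (cid (ex p)).
(* Indices of a spanning family: primitive vectors, and images of F from the
   spaces mu + (k + 1) a with k < N; the higher ones are zero. *)
pose I : finType := ('I_d + {p : P & 'I_(n p)})%type.
pose f (i : I) : M mu := match i with
  | inl i => b i
  | inr q => opF M mu (tag q).1 (tag q).2.+1 (e (tag q) (tagged q)) end.
apply: (spans_finType (b := f)) => u.
pose U u := exists a : I -> K, u = \sum_i a i *: f i.
have hU : subspace U.
  split; first by exists (fun=> 0); rewrite big1 // => i _; rewrite scale0r.
  move=> k _ _ [a ->] [a' ->]; exists (fun i => k * a i + a' i).
  rewrite scaler_sumr -big_split /=; apply: eq_bigr => i _.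
  by rewrite scalerA scalerDl.
have hf i : U (f i).
  exists (fun j => (j == i)%:R); rewrite (bigD1 i) //= eqxx scale1r big1 ?addr0 //.
  by move=> j /negbTE ->; rewrite scale0r.
have [hs _] := h3 mu; have [v [w [hv hw ->]]] := hs u.
apply: (subspaceD hU).
  have [a ->] := hbs v hv; apply: (subspace_sum _ hU) => i _.
  by apply: (subspaceZ _ hU); apply: (hf (inl i)).
apply: (imF_ind hU _ hw) => a k x.
have [hk|hk] := ltnP k N.
  have [co ->] := eP (a, Ordinal hk) x Logic.I.
  rewrite linear_sum; apply: (subspace_sum _ hU) => i _; rewrite linearZ.
  by apply: (subspaceZ _ hU); apply: (hf (inr (Tagged (fun p => 'I_(n p)) i))).
have -> : x = 0; last by rewrite linear0; case: hU.
apply: contrapT => hx.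
have := hN (mu + wt a *~ k.+1) (nseq k.+1 a); rewrite size_nseq ltnNge (leqW hk) => hh.
suff : false by []. apply: hh; first by exists x.
by rewrite addrC addKr wt_mulz_sum.
Qed.

End Simple.

(** * Classification *)

Section Classification.
Variables (F : archiRealFieldType) (V : vectType F) (R : root_system V).
Variables (Pi : root_basis R) (K : fieldType) (c : coefficients Pi K).
Local Notation X := (weight R).
Local Notation simple_root := (simple_root Pi).
Local Notation opspace := (opspace Pi K).
Local Open Scope classical_set_scope.

Lemma obj_preobject (M : object c) : preobject c M.
Proof. by split; [exact: obj_X2|exact: obj_X3|case: (obj_X1 M)]. Qed.

Lemma obj_kerE_dim (M : object c) mu : exists d, kerE_dim M mu d.
Proof.
have [_ /(_ mu)[n /has_dim_spans[b [_ _ hb]]]] := obj_X1 M.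
have [d [b' hb']] : exists d (b' : 'I_d -> M mu), is_basis (kerE (M := M) (mu := mu)) b'.
  apply: (ex_basis (kerE_subspace M mu) (b := b)) => u _; exact: hb.
by exists d, b'.
Qed.

Lemma preobject_object (M : opspace) : preobject c M -> (forall mu, exists d, kerE_dim M mu d) ->
  exists O : object c, obj_space O = M.
Proof.
move=> hM hd; have [h2 h3 h1] := hM.
have h1' : axX1 M.
  split=> // mu; have [n [b hb]] := preobject_fin_dim hM hd mu.
  exact: spans_has_dim hb.
by exists (Object h1' h2 h3).
Qed.

Lemma kerE_dim_unique (M : opspace) mu m n : kerE_dim M mu m -> kerE_dim M mu n -> m = n.
Proof. by move=> [b hb] [b' hb']; apply: basis_size hb hb'. Qed.

Lemma kerE_dim_zero (M : opspace) : preobject c M -> (forall mu, kerE_dim M mu 0) -> is_zero M.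
Proof.
move=> [_ h3 hb] h mu v.
elim: (gen_kerE hb h3 v) => {mu v} [mu v hv|mu|mu k u v _ -> _ ->|mu a k v _ ->] //.
- exact: kerE_dim0_eq0 (h mu) _ hv.
- by rewrite scaler0 addr0.
by rewrite linear0.
Qed.

Lemma zero_kerE_dim (M : opspace) mu : is_zero M -> kerE_dim M mu 0.
Proof.
move=> h; exists (fun=> 0); split=> [[]|a _ []|u _] //.
by exists (fun=> 0); rewrite big_ord0; apply: h.
Qed.

(** No weights lie above la, so the image of F_la is zero. *)
Lemma kerE_top (S : opspace) la : (forall mu, weights S mu -> wle Pi mu la) ->
  axX3 S -> forall v : S la, kerE v.
Proof.
move=> hw h3 v; have [hs _] := h3 la; have [u [w [hu hi ->]]] := hs v.
suff -> : w = 0 by rewrite addr0.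
apply: (imF_ind (U := fun w => w = 0) _ _ hi).
  by split=> // k x y -> ->; rewrite scaler0 addr0.
move=> a k x; have -> : x = 0; last by rewrite linear0.
apply: contrapT => hx.
have h1 : wle Pi (la + wt a *~ k.+1) la by apply: hw; exists x.
have [s hs'] := h1.
have /size_root_sum : \sum_(b <- nseq k.+1 a ++ s) wt b =
    \sum_(b <- [::] : seq simple_root) wt b.
  rewrite big_cat -hs' -wt_mulz_sum big_nil opprD (addrA la) subrr add0r.
  exact: subrr.
by [].
Qed.

(** The properties of S(la) that determine it and that make sums of such spaces
    quasi-bounded. *)
Definition highest la (S : opspace) :=
  [/\ preobject c S, primitive_at la S & forall mu, weights S mu -> wle Pi mu la].

Lemma highest_has_dim la (S : opspace) : highest la S -> has_dim 1 (S la).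
Proof.
move=> [[_ h3 _] hp hw]; have := hp la; rewrite eqxx => -[b [h1 h2 h']].
apply: (basis_has_dim (b := b)); split=> // u _; apply: h'.
exact: kerE_top.
Qed.

(** Dimensions of kernels of E add up in a direct sum, and their total over all
    weights is 1. *)
Lemma primitive_indecomposable la (S : object c) : primitive_at la S -> indecomposable S.
Proof.
move=> hp; split.
  move=> /(zero_kerE_dim la) h0; have := kerE_dim_unique (hp la) h0.
  by rewrite eqxx.
move=> A B iso.
have hs mu : exists m n, [/\ kerE_dim A mu m, kerE_dim B mu n & (m + n)%N = (mu == la)].
  have [m hm] := obj_kerE_dim A mu; have [n hn] := obj_kerE_dim B mu.
  exists m, n; split=> //; apply: kerE_dim_unique (sum2_kerE_dim hm hn) _.
  exact: kerE_dim_opiso iso (hp mu).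
have [m [n [hm hn e]]] := hs la.
have out (O : object c) : kerE_dim O la 0 ->
    (forall mu, mu != la -> kerE_dim O mu 0) -> is_zero O.
  move=> h0 h; apply: (kerE_dim_zero (obj_preobject O)) => mu.
  by have [->|/h] := eqVneq mu la.
move: e; rewrite eqxx; case: m hm => [|[|m]] hm //.
  move=> _; left; apply: out => // mu ne; have [m' [n' [hm' _]]] := hs mu.
  by rewrite (negbTE ne); case: m' hm'.
case: n hn => // hn _; right; apply: out => // mu ne.
have [m' [n' [_ hn']]] := hs mu.
by rewrite (negbTE ne); case: m'; case: n' hn'.
Qed.

Lemma primitive_unique la (S S' : opspace) : preobject c S -> preobject c S' ->
  primitive_at la S -> primitive_at la S' -> opiso S S'.
Proof. by move=> h h' hp hp'; apply: (lift_iso h h') => mu; exists (mu == la : nat). Qed.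

Lemma bsum_preobject (S : X -> opspace) (J : Type) (w : J -> X) (T : set X) :
  (forall la, highest la (S la)) -> quasi_bounded Pi T -> (forall j, T (w j)) ->
  preobject c (bsum (fun j => S (w j))).
Proof.
move=> hS hT hw; split.
- by apply: bsum_X2 => j; have [[]] := hS (w j).
- by apply: bsum_X3 => j; have [[]] := hS (w j).
apply: quasi_bounded_sub (quasi_bounded_down hT) => mu [v hv].
have [j hj] : exists j, v j <> 0.
  apply: contrapT => h; apply: hv; apply: dsumP => j /=.
  by apply: contrapT => hj; apply: h; exists j.
exists (w j) => //; have [_ _] := hS (w j); apply.
by exists (v j).
Qed.

(** Take d mu copies of S mu for every mu. *)
Lemma bsum_realize (S : X -> opspace) (d : X -> nat) :
  (forall la, highest la (S la)) -> quasi_bounded Pi [set mu | (0 < d mu)%N] ->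
  exists (J : Type) (w : J -> X), preobject c (bsum (fun j => S (w j))) /\
    forall mu, kerE_dim (bsum (fun j => S (w j))) mu (d mu).
Proof.
move=> hS hd; pose J := {mu : X & 'I_(d mu)}.
exists J, (fun j => tag j); split.
  apply: (bsum_preobject hS hd) => -[mu i] /=.
  by apply: leq_ltn_trans (ltn_ord i).
move=> mu; pose l : seq J := [seq Tagged (fun mu => 'I_(d mu)) i | i <- enum 'I_(d mu)].
have -> : d mu = size l by rewrite size_map size_enum_ord.
apply: (@bsum_kerE_dim _ _ _ _ _ J (fun j => S (tag j)) (fun j => tag j)).
- by move=> j; have [] := hS (tag j).
- by rewrite map_inj_uniq ?enum_uniq // => i i' /eqP; rewrite eq_Tagged => /eqP.
move=> [nu i]; split=> [|/= e].
  by rewrite /l => /mapP[i' _ ->].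
  by rewrite /l; case: _ / e {l}; apply/mapP; exists i => //; rewrite mem_enum.
Qed.

Lemma weights_dim (M : object c) (d : X -> nat) : (forall mu, kerE_dim M mu (d mu)) ->
  quasi_bounded Pi [set mu | (0 < d mu)%N].
Proof.
move=> hd; have [h _] := obj_X1 M; apply: quasi_bounded_sub h => mu /= h0.
have [b [_ hi _]] := hd mu.
exists (b (Ordinal h0)) => e.
have s0 : \sum_i (i == Ordinal h0)%:R *: b i = 0.
  rewrite (bigD1 (Ordinal h0)) //= e scaler0 add0r big1 //.
  by move=> i /negbTE ->; rewrite scale0r.
by have /eqP := hi _ s0 (Ordinal h0); rewrite eqxx oner_eq0.
Qed.

Lemma decomposition (S : X -> opspace) (M : object c) :
  (forall la, highest la (S la)) ->
  exists (J : Type) (w : J -> X), opiso M (bsum (fun j => S (w j))).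
Proof.
move=> hS; have /choice[d hd] := obj_kerE_dim M.
have [J [w [hg hk]]] := bsum_realize hS (weights_dim hd).
exists J, w; apply: (lift_iso (obj_preobject M) hg) => mu.
by exists (d mu).
Qed.

Lemma S_highest la : highest la (S_opspace c la).
Proof.
split; [exact: S_preobject|exact: S_primitive|exact: S_weights].
Qed.

(** In weight la all vectors are primitive by [kerE_top]. By dimensions of the
    kernels of E, S is therefore the sum of S(la) and of an object B with the
    remaining dimensions, so B = 0 by indecomposability. *)
Lemma is_S_primitive la (S : object c) : is_S la S -> primitive_at la S.
Proof.
move=> [[nz hind] h1 hw].
have /choice[d hd] := obj_kerE_dim S.
have dla : d la = 1%N.
  have [b hb] := has_dim_spans h1; have [b' [k1 k2 k3]] := hd la.
  apply: (@basis_size _ _ (fun=> True) _ _ b' b) => //; split=> // u _.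
  by apply: k3; apply: kerE_top => //; apply: obj_X3.
(* The dimensions of the kernels of E for the complement of S(la). *)
pose d' mu := (d mu - (mu == la))%N.
have hd' : quasi_bounded Pi [set mu | (0 < d' mu)%N].
  apply: quasi_bounded_sub (weights_dim hd) => mu /=.
  by rewrite subn_gt0; apply: leq_ltn_trans.
have [J [w [hg hk]]] := bsum_realize S_highest hd'.
have [B eB] := preobject_object hg (fun mu => ex_intro _ _ (hk mu)).
have [A eA] := preobject_object (S_preobject c la) (fun mu => ex_intro _ _ (S_primitive c la mu)).
have dsplit mu : ((mu == la) + d' mu)%N = d mu.
  by rewrite /d' subnKC //; case: eqP => // ->; rewrite dla.
have iso : opiso S (sum2 A B).
  apply: (lift_iso (obj_preobject S)) => [|mu].
    by apply: sum2_preobject; apply: obj_preobject.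
  exists (d mu); split=> //; rewrite -dsplit eA eB; apply: sum2_kerE_dim => //.
  exact: S_primitive.
have [zA|zB] := hind _ _ iso.
  have := kerE_dim_unique (zero_kerE_dim la zA); rewrite eA.
  by move=> /(_ _ (S_primitive c la la)); rewrite eqxx.
move=> mu; suff -> : (mu == la) = d mu :> nat by [].
have := kerE_dim_unique (zero_kerE_dim mu zB); rewrite eB => /(_ _ (hk mu)) e.
by rewrite -dsplit -e addn0.
Qed.

Lemma is_S_highest la (S : object c) : is_S la S -> highest la S.
Proof. by move=> h; split; [exact: obj_preobject|exact: is_S_primitive|case: h]. Qed.

Lemma exists_S la : exists S : object c, is_S la S.
Proof.
have [S eS] := preobject_object (S_preobject c la) (fun mu => ex_intro _ _ (S_primitive c la mu)).
have h : highest la S by rewrite eS; apply: S_highest.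
exists S; split; [|exact: highest_has_dim|by case: h].
by apply: (primitive_indecomposable (la := la)); case: h.
Qed.

(** A primitive vector of S has weight la, where S' has no nonzero primitive
    vector. *)
Lemma primitive_hom_eq0 la mu (S S' : opspace) :
  preobject c S -> primitive_at la S -> primitive_at mu S' -> mu <> la ->
  forall (f : ophom S S') nu (v : S nu), f nu v = 0.
Proof.
move=> [_ h3 hb] hp hp' ne f nu v.
(* f vanishes because it equals 0 *: f. *)
rewrite (hom_ext (k := 0) (g := f) hb h3) ?scale0r // => xi u hu.
rewrite scale0r.
have [e|ne'] := eqVneq xi la.
  apply: kerE_dim0_eq0 (hom_kerE f hu).
  have := hp' xi; rewrite e; suff -> : (la == mu) = false by [].
  by apply/eqP => e'; apply: ne.
have -> : u = 0; last by rewrite linear0.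
by apply: kerE_dim0_eq0 hu; have := hp xi; rewrite (negbTE ne').
Qed.

(** On the line of primitive vectors f is a scalar. *)
Lemma primitive_hom_scalar la (S : opspace) : preobject c S -> primitive_at la S ->
  forall f : ophom S S, exists k : K, forall nu (v : S nu), f nu v = k *: v.
Proof.
move=> [_ h3 hb] hp f.
have [q /(_ erefl)[hq _ hs]] := primitive_vector la hp.
have [k hk] := hs _ (hom_kerE f hq).
exists k => nu v; apply: (hom_ext (g := hom_id S)) => // xi u hu.
have [e|ne] := eqVneq xi la; last first.
  have -> : u = 0; last by rewrite !linear0.
  by apply: kerE_dim0_eq0 hu; have := hp xi; rewrite (negbTE ne).
case: _ / (esym e) u hu => u /hs[k' ->].
by rewrite linearZ hk /= !scalerA mulrC.
Qed.

(** A list of maximal length without repetitions exhausts P. *)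
Lemma fibre_list (J : eqType) (P : J -> Prop) d :
  (forall l : seq J, uniq l -> (forall j, j \in l -> P j) -> (size l <= d)%N) ->
  exists2 l : seq J, uniq l & forall j, j \in l <-> P j.
Proof.
move=> hd.
pose Q n := `[< exists l : seq J, [/\ uniq l, forall j, j \in l -> P j & size l = n] >].
have Q0 : exists n, Q n by exists 0%N; apply/asboolP; exists [::].
have Qd n : Q n -> (n <= d)%N.
  by move=> /asboolP[l [h1 h2 <-]]; apply: hd.
have [n /asboolP[l [h1 h2 e]] hmax] := ex_maxnP Q0 Qd.
exists l => // j; split; first exact: h2.
move=> hj; apply: contrapT => /negP hjl.
have : Q n.+1.
  apply/asboolP; exists (j :: l); split=> /=; last by rewrite e.
    by rewrite hjl.
  by move=> i; rewrite inE => /orP[/eqP->|/h2].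
by move=> /hmax; rewrite ltnn.
Qed.

Lemma fibre_size (S : X -> opspace) (J : eqType) (w : J -> X) (M : object c) :
  (forall la, highest la (S la)) -> opiso M (bsum (fun j => S (w j))) ->
  forall d, (forall mu, kerE_dim M mu (d mu)) ->
  forall mu, exists l : seq J, [/\ uniq l, size l = d mu & forall j, j \in l <-> w j = mu].
Proof.
move=> hS iso d hd mu.
have hp j : primitive_at (w j) (S (w j)) by have [] := hS (w j).
have hk : kerE_dim (bsum (fun j => S (w j))) mu (d mu) by apply: kerE_dim_opiso iso (hd mu).
have [|l hl hw] := @fibre_list J (fun j => w j = mu) (d mu).
  move=> l hl hw; have [b [h1 h2 _]] := bsum_indep hp hl hw.
  by have [b' [_ _ h3']] := hk; apply: indep_le h3' h1 h2.
exists l; split=> //.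
exact: kerE_dim_unique (bsum_kerE_dim hp hl hw) hk.
Qed.

(** Match elements of corresponding fibres by their positions in the
    enumerations. *)
Lemma fibre_bij (J J' : eqType) (w : J -> X) (w' : J' -> X) (d : X -> nat) :
  (forall mu, exists l : seq J, [/\ uniq l, size l = d mu & forall j, j \in l <-> w j = mu]) ->
  (forall mu, exists l : seq J', [/\ uniq l, size l = d mu & forall j, j \in l <-> w' j = mu]) ->
  exists2 s : J -> J', bijective s & forall j, w' (s j) = w j.
Proof.
move=> /choice[l hl] /choice[l' hl'].
(* The element of the other fibre at the same position. *)
have half (I I' : eqType) (u : I -> X) (u' : I' -> X) (m : X -> seq I) (m' : X -> seq I') :
    (forall mu, [/\ uniq (m mu), size (m mu) = d mu & forall j, j \in m mu <-> u j = mu]) ->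
    (forall mu, [/\ uniq (m' mu), size (m' mu) = d mu & forall j, j \in m' mu <-> u' j = mu]) ->
    forall i, exists i', u' i' = u i /\ index i' (m' (u i)) = index i (m (u i)).
  move=> hm hm' i; have [h1 h2 h3] := hm (u i); have [h1' h2' h3'] := hm' (u i).
  have hi : (index i (m (u i)) < size (m' (u i)))%N.
    by rewrite h2' -h2 index_mem; apply/h3.
  case E : (m' (u i)) hi h1' h3' => [//|x s] hi hu hmem.
  exists (nth x (x :: s) (index i (m (u i)))); split; last exact: index_uniq.
  by apply/hmem; rewrite mem_nth.
have /choice[s hs] := half _ _ _ _ _ _ hl hl'.
have /choice[s' hs'] := half _ _ _ _ _ _ hl' hl.
have canc (I I' : eqType) (u : I -> X) (u' : I' -> X) (m : X -> seq I) (m' : X -> seq I')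
    (t : I -> I') (t' : I' -> I) : (forall mu j, j \in m mu <-> u j = mu) ->
    (forall i, u' (t i) = u i /\ index (t i) (m' (u i)) = index i (m (u i))) ->
    (forall i, u (t' i) = u' i /\ index (t' i) (m (u' i)) = index i (m' (u' i))) ->
    cancel t t'.
  move=> hm ht ht' i; have [e1 e2] := ht i; have [e1' e2'] := ht' (t i).
  have h : i \in m (u i) by apply/hm.
  have h' : t' (t i) \in m (u i) by apply/hm; rewrite e1' e1.
  by rewrite -(nth_index i h') -[RHS](nth_index i h); congr nth; rewrite -e2 -e1 e2'.
exists s; last by move=> j; have [] := hs j.
exists s'.
  by apply: (canc _ _ w w' l l') => // mu j; have [_ _] := hl mu; apply.
by apply: (canc _ _ w' w l' l) => // mu j; have [_ _] := hl' mu; apply.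
Qed.

End Classification.

Theorem theoremA (F : archiRealFieldType) (V : vectType F) (R : root_system V)
    (Pi : root_basis R) (K : fieldType) (c : coefficients Pi K) :
  (forall la : weight R,
     (exists S : object c, is_S la S) /\
     (forall S S' : object c, is_S la S -> is_S la S' -> opiso S S')) /\
  (forall S : weight R -> object c, (forall la, is_S la (S la)) ->
     (forall la mu, mu <> la ->
        forall (f : ophom (S la) (S mu)) nu (v : S la nu), f nu v = 0) /\
     (forall la (f : ophom (S la) (S la)),
        exists k : K, forall nu (v : S la nu), f nu v = k *: v) /\
     (forall M : object c,
        (exists (J : Type) (w : J -> weight R),
           opiso M (bsum (fun j => S (w j)))) /\
        (forall (J J' : Type) (w : J -> weight R) (w' : J' -> weight R),
           opiso M (bsum (fun j => S (w j))) ->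
           opiso M (bsum (fun j => S (w' j))) ->
           exists2 s : J -> J', bijective s & forall j, w' (s j) = w j))).
Proof.
split=> [la|S hS].
  split; first exact: exists_S.
  move=> S S' /is_S_primitive h /is_S_primitive h'.
  exact: primitive_unique (obj_preobject S) (obj_preobject S') h h'.
have hh la : highest c la (S la) by apply: is_S_highest.
have hp la : primitive_at la (S la) by have [] := hh la.
split; [|split].
- move=> la mu ne; exact: primitive_hom_eq0 (obj_preobject (S la)) (hp la) (hp mu) ne.
- move=> la; exact: primitive_hom_scalar (obj_preobject (S la)) (hp la).
move=> M; split; first exact: (decomposition M hh).
move=> J J' w w' iso iso'.
have /choice[d hd] := obj_kerE_dim M.
exact: (@fibre_bij _ _ _ {classic J} {classic J'} w w' d
  (@fibre_size _ _ _ _ _ _ _ {classic J} w M hh iso d hd)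
  (@fibre_size _ _ _ _ _ _ _ {classic J'} w' M hh iso' d hd)).
Qed.
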